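(* Let $\mathbf{H}\in\mathbb{H}^4$. The following are equivalent: (1) $\mathbf{Cov}_2(\mathbf{H})$ is orthotropic; (2) $\mathbf{H}$ is orthotropic; (3) $\mathbf{v}_5=\mathbf{v}_6=0$ and the pair $(\mathbf{d}_2,\mathbf{c}_3)$ is orthotropic. In that case the symmetry group of $\mathbf{H}$ equals the symmetry group of the triple $(\mathbf{d}_2,\mathbf{c}_3,\mathbf{c}_4)$.
   Context: $\mathbb{H}^4$ is the space of totally symmetric traceless fourth-order tensors on $\mathbb{R}^3$, with $SO(3)$-action $(g\star\mathbf{T})(x_1,\dots,x_n)=\mathbf{T}(g^{-1}x_1,\dots,g^{-1}x_n)$. $\mathbf{Cov}_2(\mathbf{H})\subset\mathrm{Sym}^2(\mathbb{R}^3)$ is the set of values at $\mathbf{H}$ of all $SO(3)$-equivariant polynomial maps $\mathbb{H}^4\to\mathrm{Sym}^2(\mathbb{R}^3)$. $(\mathbf{H}:\mathbf{H})_{ijkl}=H_{ijmn}H_{mnkl}$, $(\mathbf{H}:\mathbf{a})_{ij}=H_{ijkl}a_{kl}$, $(\operatorname{tr}_{13}\mathbf{A})_{ij}=A_{kikj}$, $\mathbf{d}_2=\operatorname{tr}_{13}(\mathbf{H}:\mathbf{H})$, $\mathbf{c}_3=\mathbf{H}:\mathbf{d}_2$, $\mathbf{c}_4=\mathbf{H}:\mathbf{c}_3$. $\mathbf{v}_5$ and $\mathbf{v}_6$ are the vectors with components $(\mathbf{v}_5)_i=\varepsilon_{ijk}(\mathbf{d}_2\mathbf{c}_3)_{jk}$,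 $(\mathbf{v}_6)_i=\varepsilon_{ijk}(\mathbf{d}_2\mathbf{c}_4)_{jk}$, where $\varepsilon$ is the Levi-Civita tensor and products of second-order tensors are matrix products. Symmetry group of a tensor: $\{g\in SO(3):g\star\mathbf{T}=\mathbf{T}\}$; of a family or subspace: intersection; symmetry class: conjugacy class. Orthotropic $=[\mathbb{D}_2]$, $\mathbb{D}_2$ the group of rotations by $\pi$ about the three coordinate axes (with identity). *)

(* Defs.v *)
From HB Require Import structures.
From mathcomp Require Import all_boot all_order all_algebra.
From mathcomp Require Import reals.
Set Implicit Arguments. Unset Strict Implicit. Unset Printing Implicit Defensive.
Import Order.TTheory GRing.Theory Num.Theory.
Local Open Scope ring_scope.

Section Defs.
Variable R : realType.

Definition T4 := 'I_3 -> 'I_3 -> 'I_3 -> 'I_3 -> R.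

Definition SO3 (g : 'M[R]_3) : Prop := g^T *m g = 1%:M /\ \det g = 1.

(* (g * T)(x1..x4) = T(g^-1 x1, ..., g^-1 x4), in components *)
Definition act4 (g : 'M[R]_3) (T : T4) : T4 := fun i j k l =>
  \sum_(a < 3) \sum_(b < 3) \sum_(c < 3) \sum_(d < 3)
     g i a * g j b * g k c * g l d * T a b c d.

Definition act2 (g : 'M[R]_3) (a : 'M[R]_3) : 'M[R]_3 := g *m a *m g^T.

Definition eqT4 (T U : T4) : Prop := forall i j k l, T i j k l = U i j k l.

(* H^4: totally symmetric (invariant under the transpositions (12),(23),(34),
   which generate S_4) and traceless *)
Definition inH4 (H : T4) : Prop :=
  (forall i j k l, H i j k l = H j i k l) /\
  (forall i j k l, H i j k l = H i k j l) /\
  (forall i j k l, H i j k l = H i j l k) /\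
  (forall i j, \sum_(k < 3) H k k i j = 0).

Definition symmx (a : 'M[R]_3) : Prop := a^T = a.

Inductive polyfun : (T4 -> R) -> Prop :=
| pf_const (c : R) : polyfun (fun _ => c)
| pf_coord (i j k l : 'I_3) : polyfun (fun T => T i j k l)
| pf_add f g : polyfun f -> polyfun g -> polyfun (fun T => f T + g T)
| pf_mul f g : polyfun f -> polyfun g -> polyfun (fun T => f T * g T)
| pf_ext f g : (forall T, f T = g T) -> polyfun f -> polyfun g.

Definition cov2map (f : T4 -> 'M[R]_3) : Prop :=
  (forall i j, polyfun (fun T => f T i j)) /\
  (forall H, inH4 H -> symmx (f H)) /\
  (forall g H, SO3 g -> inH4 H -> f (act4 g H) = act2 g (f H)).

Definition Cov2 (H : T4) (a : 'M[R]_3) : Prop :=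
  exists f, cov2map f /\ a = f H.

Definition symgrpT4 (H : T4) (g : 'M[R]_3) : Prop := SO3 g /\ eqT4 (act4 g H) H.
Definition symgrpSet (S : 'M[R]_3 -> Prop) (g : 'M[R]_3) : Prop :=
  SO3 g /\ forall a, S a -> act2 g a = a.

Definition D2 (d : 'M[R]_3) : Prop :=
  d = 1%:M \/ d = diag_mx (\row_i (if i == 0 :> nat then 1 else -1)) \/
  d = diag_mx (\row_i (if i == 1 :> nat then 1 else -1)) \/
  d = diag_mx (\row_i (if i == 2 :> nat then 1 else -1)).

Definition orthotropic_grp (G : 'M[R]_3 -> Prop) : Prop :=
  exists Q, SO3 Q /\ forall g, G g <-> exists d, D2 d /\ g = Q *m d *m Q^T.

Definition dd4 (A B : T4) : T4 := fun i j k l =>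
  \sum_(m < 3) \sum_(n < 3) A i j m n * B m n k l.
Definition dd2 (A : T4) (a : 'M[R]_3) : 'M[R]_3 :=
  \matrix_(i, j) \sum_(k < 3) \sum_(l < 3) A i j k l * a k l.
Definition tr13 (A : T4) : 'M[R]_3 := \matrix_(i, j) \sum_(k < 3) A k i k j.

Definition d2 (H : T4) : 'M[R]_3 := tr13 (dd4 H H).
Definition c3 (H : T4) : 'M[R]_3 := dd2 H (d2 H).
Definition c4 (H : T4) : 'M[R]_3 := dd2 H (c3 H).

(* Levi-Civita symbol on indices 0,1,2 *)
Definition levi (i j k : 'I_3) : R :=
  ((j%:R - i%:R) * (k%:R - i%:R) * (k%:R - j%:R)) / 2.

Definition vecof (a : 'M[R]_3) : 'cV[R]_3 :=
  \col_i \sum_(j < 3) \sum_(k < 3) levi i j k * a j k.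

Definition v5 (H : T4) : 'cV[R]_3 := vecof (d2 H *m c3 H).
Definition v6 (H : T4) : 'cV[R]_3 := vecof (d2 H *m c4 H).

End Defs.

(* Main.v *)
Require Import Defs.
From HB Require Import structures.
From mathcomp Require Import all_boot all_order all_algebra.
From mathcomp Require Import reals.
From mathcomp Require Import boolp classical_sets topology normedtype derive ring lra.
Import Order.TTheory GRing.Theory Num.Theory.
Import numFieldNormedType.Exports.
Local Open Scope ring_scope.
Set Implicit Arguments. Unset Strict Implicit. Unset Printing Implicit Defensive.

(** Rotating H, one may assume that the group in question is D2 itself; H is then fixed by D2
    iff its components H_{mmpq} with p <> q vanish, and all covariants involved are diagonal.
    Write x, z for the diagonals of d2, c3.

    (2) => (3).  With a = H_{2233}, b = H_{1133}, c = H_{1122} one has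
    x1 - x2 = (b - a)(4a + 4b + 2c), and z1 - z2 = (b - a)(x3 - x1) when x1 = x2.  A coincidence
    among a, b, c gives H a fourfold axis, so a, b, c are distinct; then x1 = x2 and z1 = z2
    cannot both hold.

    (3) => (2).  c3 = H : d2 diagonal says that (H_{mmpq})_m is orthogonal to (1, 1, 1) and x,
    and v6 = 0 that it is orthogonal to z when x_p <> x_q.  If 1, x, z are independent this is
    enough (a double eigenvalue of d2 is settled by d2_{pq} = 0).  Otherwise x is simple and
    H_{mm12}, H_{mm13}, H_{mm23} are u y, v y, w y with y = (x2 - x3, x3 - x1, x1 - x2), and
    solving the off-diagonal equations of d2 with (u, v, w) <> 0 makes d2 spherical, which
    contradicts the simplicity of x.

    (1) => (2).  If (d2, c3) is orthotropic use (3) => (2).  Otherwise (d2, c3) has a common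
    axis, and H is shown to have a symmetry of order 3 or 4, which fixes Cov_2(H) but is not in
    D2: if d2 is not spherical this follows from the equations along the axis; if d2 is
    spherical, an extremal frame for H_{3333} and then H_{1133} supplies an axis. *)

(** * Action of matrices on tensors *)

Section TensorAction.
Variable R : realType.
Implicit Types (g h : 'M[R]_3) (H T : T4 R).

Definition ap g (v : 'I_3 -> R) (i : 'I_3) : R := \sum_a g i a * v a.

Lemma ap_mul g h v : ap (g *m h) v = ap g (ap h v).
Proof.
apply/funext => i; rewrite /ap.
under eq_bigr do rewrite mxE mulr_suml.
rewrite exchange_big; apply: eq_bigr => a _.
by rewrite mulr_sumr; apply: eq_bigr => b _; rewrite mulrA.
Qed.

Lemma ap1 v : ap 1%:M v = v.
Proof.
apply/funext => i; rewrite /ap (bigD1 i) //= mxE eqxx mul1r big1 ?addr0 //.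
by move=> j ji; rewrite mxE eq_sym (negPf ji) mul0r.
Qed.

Lemma ap_swap g h (F : 'I_3 -> 'I_3 -> R) i j :
  ap g (fun a => ap h (fun b => F a b) j) i = ap h (fun b => ap g (fun a => F a b) i) j.
Proof.
rewrite /ap; under eq_bigr do rewrite mulr_sumr.
rewrite exchange_big; apply: eq_bigr => b _; rewrite mulr_sumr.
by apply: eq_bigr => a _; rewrite mulrCA.
Qed.

(** Summing over the common index brings g^T and g together, so the two rotations cancel; the
    equivariance proofs below remove their contracted indices this way. *)
Lemma trace_ap g (F : 'I_3 -> 'I_3 -> R) : g^T *m g = 1%:M ->
  \sum_i ap g (fun a => ap g (F a) i) i = \sum_i F i i.
Proof.
move=> gg; rewrite /ap.
rewrite exchange_big; apply: eq_bigr => a _.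
under eq_bigr do rewrite mulr_sumr.
rewrite exchange_big /= -[RHS](congr1 (fun f => f a) (ap1 (F a))) -gg /ap.
apply: eq_bigr => b _; rewrite !mxE mulr_suml; apply: eq_bigr => i _.
by rewrite mxE mulrA.
Qed.

Lemma ap_scale g c v i : ap g (fun a => c * v a) i = c * ap g v i.
Proof. by rewrite /ap mulr_sumr; apply: eq_bigr => a _; rewrite mulrCA. Qed.

Lemma sum_ap g v w : g^T *m g = 1%:M ->
  \sum_i ap g v i * ap g w i = \sum_i v i * w i.
Proof.
move=> gg; rewrite -(trace_ap (fun a b => v a * w b) gg); apply: eq_bigr => i _.
rewrite mulrC -ap_scale; congr ap; apply/funext => a.
by rewrite ap_scale mulrC.
Qed.

Lemma sum_ap_fun g (F : 'I_3 -> 'I_3 -> R) l :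
  \sum_n ap g (F n) l = ap g (fun a => \sum_n F n a) l.
Proof. by rewrite /ap exchange_big; apply: eq_bigr => a _; rewrite mulr_sumr. Qed.

(** The four one-index actions composing [act4] commute, so the action on any contracted index can
    be brought outermost and cancelled on its own. *)
Definition slot1 g T : T4 R := fun i j k l => ap g (fun a => T a j k l) i.
Definition slot2 g T : T4 R := fun i j k l => ap g (fun a => T i a k l) j.
Definition slot3 g T : T4 R := fun i j k l => ap g (fun a => T i j a l) k.
Definition slot4 g T : T4 R := fun i j k l => ap g (fun a => T i j k a) l.

Lemma T4P T U : (forall i j k l, T i j k l = U i j k l) -> T = U.
Proof.
move=> e; apply/funext => i; apply/funext => j.
by apply/funext => k; apply/funext => l; exact: e.
Qed.

Lemma act4E g T : act4 g T = slot1 g (slot2 g (slot3 g (slot4 g T))).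
Proof.
apply: T4P => i j k l.
rewrite /act4 /slot1 /slot2 /slot3 /slot4 /ap; apply: eq_bigr => a _; rewrite mulr_sumr.
apply: eq_bigr => b _; rewrite !mulr_sumr; apply: eq_bigr => c _; rewrite !mulr_sumr.
by apply: eq_bigr => d _; rewrite !mulrA.
Qed.

Lemma slot12 g h T : slot1 g (slot2 h T) = slot2 h (slot1 g T).
Proof. by apply: T4P => i j k l; rewrite /slot1 /slot2 ap_swap. Qed.
Lemma slot13 g h T : slot1 g (slot3 h T) = slot3 h (slot1 g T).
Proof. by apply: T4P => i j k l; rewrite /slot1 /slot3 ap_swap. Qed.
Lemma slot14 g h T : slot1 g (slot4 h T) = slot4 h (slot1 g T).
Proof. by apply: T4P => i j k l; rewrite /slot1 /slot4 ap_swap. Qed.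
Lemma slot23 g h T : slot2 g (slot3 h T) = slot3 h (slot2 g T).
Proof. by apply: T4P => i j k l; rewrite /slot2 /slot3 ap_swap. Qed.
Lemma slot24 g h T : slot2 g (slot4 h T) = slot4 h (slot2 g T).
Proof. by apply: T4P => i j k l; rewrite /slot2 /slot4 ap_swap. Qed.
Lemma slot34 g h T : slot3 g (slot4 h T) = slot4 h (slot3 g T).
Proof. by apply: T4P => i j k l; rewrite /slot3 /slot4 ap_swap. Qed.

Lemma act4_mul g h T : act4 (g *m h) T = act4 g (act4 h T).
Proof.
have e1 U : slot1 (g *m h) U = slot1 g (slot1 h U).
  by apply: T4P => i j k l; rewrite /slot1 ap_mul.
have e2 U : slot2 (g *m h) U = slot2 g (slot2 h U).
  by apply: T4P => i j k l; rewrite /slot2 ap_mul.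
have e3 U : slot3 (g *m h) U = slot3 g (slot3 h U).
  by apply: T4P => i j k l; rewrite /slot3 ap_mul.
have e4 U : slot4 (g *m h) U = slot4 g (slot4 h U).
  by apply: T4P => i j k l; rewrite /slot4 ap_mul.
by rewrite !act4E e1 e2 e3 e4 !(slot12 h) !(slot13 h) !(slot14 h) !(slot23 h) !(slot24 h)
  !(slot34 h) !slot12 !slot13 !slot14 !slot23 !slot24 !slot34.
Qed.

Lemma act4_1 T : act4 1%:M T = T.
Proof. by rewrite act4E; apply: T4P => i j k l; rewrite /slot1 /slot2 /slot3 /slot4 !ap1. Qed.

Lemma inH4_act g H : g^T *m g = 1%:M -> inH4 H -> inH4 (act4 g H).
Proof.
move=> gg [s12 [s23 [s34 tr]]]; rewrite /inH4; split; [|split; [|split]].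
- move=> i j k l; rewrite act4E {1}/slot1 {1}/slot2 ap_swap [in RHS]/slot1 [in RHS]/slot2.
  congr ap; apply/funext => b; congr ap; apply/funext => a.
  by rewrite /slot3 /slot4; congr ap; apply/funext => c; congr ap; apply/funext => d.
- move=> i j k l; rewrite act4E /slot1 /slot2 /slot3; congr ap; apply/funext => a.
  rewrite ap_swap; congr ap; apply/funext => b; congr ap; apply/funext => c.
  by rewrite /slot4; congr ap; apply/funext => d.
- move=> i j k l; rewrite act4E /slot1 /slot2 /slot3 /slot4; congr ap; apply/funext => a.
  congr ap; apply/funext => b.
  rewrite ap_swap; congr ap; apply/funext => d; congr ap; apply/funext => c.
  exact: s34.
move=> i j; rewrite act4E /slot1 /slot2.
rewrite (trace_ap (fun a b => slot3 g (slot4 g H) a b i j) gg) /slot3 /slot4 /ap.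
rewrite exchange_big big1 // => a _; rewrite -mulr_sumr exchange_big big1 ?mulr0 // => b _.
by rewrite -mulr_sumr tr mulr0.
Qed.

Lemma act2_ap g (a : 'M[R]_3) i j : act2 g a i j = ap g (fun c => ap g (fun d => a c d) j) i.
Proof.
rewrite ap_swap /act2 mxE /ap; apply: eq_bigr => k _; rewrite !mxE mulrC.
by congr (_ * _); apply: eq_bigr.
Qed.

Lemma d2_act g H : g^T *m g = 1%:M -> d2 (act4 g H) = act2 g (d2 H).
Proof.
move=> gg; apply/matrixP => i j; rewrite act2_ap /d2 /tr13 /dd4 mxE.
(* The contracted indices n, m, k are cancelled in this order. What survives is slot 2 of the first
   factor, carrying i, and slot 4 of the second, carrying j. *)
have eX : act4 g H = slot4 g (slot3 g (slot1 g (slot2 g H))).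
  by rewrite act4E !slot34 !slot24 !slot14 slot23 slot13.
have eY : act4 g H = slot2 g (slot1 g (slot3 g (slot4 g H))) by rewrite act4E slot12.
transitivity (\sum_k \sum_m \sum_n slot2 g H k i m n * slot4 g H m n k j).
  rewrite {1}eX eY.
  transitivity (\sum_k \sum_m \sum_n slot3 g (slot1 g (slot2 g H)) k i m n * slot1 g (slot3 g
    (slot4 g H)) m n k j).
    by apply: eq_bigr => k _; apply: eq_bigr => m _; rewrite (sum_ap _ _ gg).
  transitivity (\sum_k \sum_n \sum_m slot1 g (slot2 g H) k i m n * slot3 g (slot4 g H) m n k j).
    apply: eq_bigr => k _; rewrite exchange_big /=.
    by apply: eq_bigr => n _; rewrite (sum_ap _ _ gg).
  rewrite exchange_big [RHS]exchange_big /=.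
  under eq_bigr do rewrite exchange_big.
  under [RHS]eq_bigr do rewrite exchange_big.
  rewrite [RHS]exchange_big /=.
  apply: eq_bigr => n _; apply: eq_bigr => m _; exact: sum_ap.
rewrite /slot2 /slot4.
under eq_bigr do under eq_bigr do under eq_bigr do
  rewrite mulrC -ap_scale.
under eq_bigr do under eq_bigr do rewrite sum_ap_fun.
under eq_bigr do rewrite sum_ap_fun.
rewrite sum_ap_fun; congr ap; apply/funext => b.
under eq_bigr do under eq_bigr do under eq_bigr do
  rewrite mulrC -ap_scale.
under eq_bigr do under eq_bigr do rewrite sum_ap_fun.
under eq_bigr do rewrite sum_ap_fun.
rewrite sum_ap_fun; congr ap; apply/funext => a.
by rewrite mxE.
Qed.

Lemma dd2_act g H a : g^T *m g = 1%:M -> dd2 (act4 g H) (act2 g a) = act2 g (dd2 H a).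
Proof.
move=> gg; apply/matrixP => i j; rewrite act2_ap mxE.
under eq_bigr do under eq_bigr do rewrite act2_ap ap_swap.
have -> : act4 g H = slot4 g (slot3 g (slot1 g (slot2 g H))).
  by rewrite act4E !slot34 !slot24 !slot14 slot23 slot13.
under eq_bigr do rewrite (sum_ap _ _ gg).
rewrite exchange_big /=.
under eq_bigr do rewrite (sum_ap _ _ gg).
rewrite exchange_big /= /slot1 /slot2.
under eq_bigr do under eq_bigr do rewrite mulrC -ap_scale.
under eq_bigr do rewrite sum_ap_fun.
rewrite sum_ap_fun; congr ap; apply/funext => c.
under eq_bigr do under eq_bigr do rewrite -ap_scale.
under eq_bigr do rewrite sum_ap_fun.
rewrite sum_ap_fun; congr ap; apply/funext => d; rewrite mxE.
by apply: eq_bigr => k _; apply: eq_bigr => l _; exact: mulrC.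
Qed.

Lemma c3_act g H : g^T *m g = 1%:M -> c3 (act4 g H) = act2 g (c3 H).
Proof. by move=> gg; rewrite /c3 d2_act // dd2_act. Qed.

Lemma c4_act g H : g^T *m g = 1%:M -> c4 (act4 g H) = act2 g (c4 H).
Proof. by move=> gg; rewrite /c4 c3_act // dd2_act. Qed.

End TensorAction.

(** * Components and covariants *)

Lemma ord3_cases (i j k m : 'I_3) : uniq [:: i; j; k] -> [|| m == i, m == j | m == k].
Proof.
by case: i j k m => [[|[|[|//]]] ?] [[|[|[|//]]] ?] [[|[|[|//]]] ?] [[|[|[|//]]] ?].
Qed.

Lemma ord3_ind (P : 'I_3 -> Prop) (i j k : 'I_3) : uniq [:: i; j; k] ->
  P i -> P j -> P k -> forall m, P m.
Proof. by move=> ijk Pi Pj Pk m; case/or3P: (ord3_cases m ijk) => /eqP->. Qed.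

Lemma ord3_third (i j : 'I_3) : i != j -> exists k, uniq [:: i; j; k].
Proof.
case: i j => [[|[|[|//]]] ?] [[|[|[|//]]] ?] // _;
  by [exists (@Ordinal 3 0 isT) | exists (@Ordinal 3 1 isT) | exists (@Ordinal 3 2 isT)].
Qed.

Lemma uniq3_rot (i j k : 'I_3) : uniq [:: i; j; k] -> uniq [:: j; k; i].
Proof. by rewrite -(rot_uniq 1). Qed.

Lemma uniq3_swap (i j k : 'I_3) : uniq [:: i; j; k] -> uniq [:: j; i; k].
Proof. by rewrite /= !inE !negb_or eq_sym => /and3P[/andP[-> ->] ->]. Qed.

Lemma uniq3P (i j k : 'I_3) : uniq [:: i; j; k] -> [/\ i != j, i != k & j != k].
Proof. by rewrite /= !inE negb_or => /and3P[/andP[-> ->] ->]. Qed.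

Section Components.
Variable R : realType.
Implicit Types (g h : 'M[R]_3) (H T : T4 R).

Lemma sum3 (i j k : 'I_3) : uniq [:: i; j; k] ->
  forall F : 'I_3 -> R, \sum_m F m = F i + F j + F k.
Proof.
move=> ijk F; have [ij ik jk] := uniq3P ijk.
rewrite (bigD1 i) // (bigD1 j) 1?eq_sym //= (bigD1 k) /=; last by rewrite ![k == _]eq_sym ik.
rewrite big_pred0 ?addr0 ?addrA // => m.
by case/or3P: (ord3_cases m ijk) => ->; rewrite ?andbF.
Qed.

Section H4.
Variables (H : T4 R) (HH : inH4 H) (i j k : 'I_3) (ijk : uniq [:: i; j; k]).

(** A tuple of equations serves as one multirule: it sorts indices into the order i, j, k, so that
    equal components become syntactically equal. *)
Lemma sort_rules :
  ((forall p q, H j i p q = H i j p q) * (forall p q, H k i p q = H i k p q) *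
   (forall p q, H k j p q = H j k p q)) *
  ((forall p q, H p j i q = H p i j q) * (forall p q, H p k i q = H p i k q) *
   (forall p q, H p k j q = H p j k q)) *
  ((forall p q, H p q j i = H p q i j) * (forall p q, H p q k i = H p q i k) *
   (forall p q, H p q k j = H p q j k)).
Proof. by case: HH => [s12 [s23 [s34 _]]]; do !split. Qed.

(** Of the fifteen sorted components, the six trace conditions eliminate six; the other nine are
    coordinates on the space of harmonic tensors. *)
Lemma trace_rules :
  ((H i i i i = - (H i i j j + H i i k k)) * (H j j j j = - (H i i j j + H j j k k)) *
   (H k k k k = - (H i i k k + H j j k k))) *
  ((H i j k k = - (H i i i j + H i j j j)) * (H i j j k = - (H i i i k + H i k k k)) *
   (H i i j k = - (H j j j k + H j k k k))).
Proof.
have [_ [_ [_ tr]]] := HH.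
have tr' p q : H i i p q + H j j p q + H k k p q = 0 by rewrite -(tr p q) (sum3 ijk).
have := (tr' i i, tr' j j, tr' k k, tr' i j, tr' i k, tr' j k).
rewrite !sort_rules => -[[[[[]]]]] e1 e2 e3 e4 e5 e6.
by do !split; lra.
Qed.

(** By symmetry d2_{ij} is the sum of H_{ipqr} H_{jpqr}; the coefficients 1, 3 and 6, here and in
    [d2_diag], count the orderings of p, q, r. *)
Lemma d2_off : d2 H i j =
  H i i i i * H i i i j + H j j j j * H j j i j + H k k i k * H k k j k
  + 3 * (H i i i j * H i i j j + H i i j j * H j j i j + H i i i k * H i i j k
         + H i i k k * H k k i j + H j j i k * H j j j k + H k k i j * H j j k k)
  + 6 * (H i i j k * H j j i k).
Proof. by rewrite /d2 /tr13 /dd4 mxE !(sum3 ijk) !sort_rules; ring. Qed.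

Lemma d2_diag : d2 H i i =
  H i i i i ^+ 2 + H j j i j ^+ 2 + H k k i k ^+ 2
  + 3 * (H i i i j ^+ 2 + H i i i k ^+ 2 + H i i j j ^+ 2 + H i i k k ^+ 2
         + H j j i k ^+ 2 + H k k i j ^+ 2)
  + 6 * H i i j k ^+ 2.
Proof. by rewrite /d2 /tr13 /dd4 mxE !(sum3 ijk) !sort_rules; ring. Qed.

Lemma dd2_diag (D : 'M[R]_3) : (forall p q, p != q -> D p q = 0) ->
  forall p q, dd2 H D p q = H i i p q * D i i + H j j p q * D j j + H k k p q * D k k.
Proof.
move=> D0 p q; have [ij ik jk] := uniq3P ijk.
case: HH => [s12 [s23 [s34 _]]].
have s m : H p q m m = H m m p q by rewrite s23 s12 s34 s23.
rewrite mxE !(sum3 ijk) !s.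
by rewrite (D0 i j) // (D0 i k) // (D0 j k) // (D0 j i) 1?eq_sym // (D0 k i) 1?eq_sym // (D0 k j)
  1?eq_sym //; ring.
Qed.

End H4.

Lemma inH4_pairswap H p q r s : inH4 H -> H p q r s = H r s p q.
Proof. by case=> [s12 [s23 [s34 _]]]; rewrite s23 s12 s34 s23. Qed.

Lemma d2_sym H : inH4 H -> symmx (d2 H).
Proof.
move=> HH; apply/matrixP => p q; rewrite mxE /d2 /tr13 /dd4 !mxE.
apply: eq_bigr => k _; apply: eq_bigr => m _; apply: eq_bigr => n _.
by rewrite mulrC (inH4_pairswap k q) // (inH4_pairswap m n).
Qed.

Lemma dd2_sym H a : inH4 H -> symmx (dd2 H a).
Proof.
case=> s12 _; apply/matrixP => p q; rewrite !mxE.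
by apply: eq_bigr => k _; apply: eq_bigr => m _; rewrite s12.
Qed.

Lemma polyfun_sum (F : 'I_3 -> T4 R -> R) :
  (forall m, polyfun (F m)) -> polyfun (fun T => \sum_m F m T).
Proof.
move=> pF; apply: (@pf_ext _ (fun T => F 0 T + F 1 T + F (1 + 1) T)).
  by move=> T; rewrite [RHS](@sum3 0 1 (1 + 1)).
by apply: pf_add => //; apply: pf_add.
Qed.

Lemma polyfun_d2 p q : polyfun (fun T : T4 R => d2 T p q).
Proof.
apply: (@pf_ext _ (fun T => \sum_k \sum_m \sum_n T k p m n * T m n k q)).
  by move=> T; rewrite mxE.
do 3!(apply: polyfun_sum => ?); apply: pf_mul; exact: pf_coord.
Qed.

Lemma polyfun_dd2 (f : T4 R -> 'M[R]_3) p q : (forall r s, polyfun (fun T => f T r s)) ->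
  polyfun (fun T => dd2 T (f T) p q).
Proof.
move=> pf; apply: (@pf_ext _ (fun T => \sum_k \sum_l T p q k l * f T k l)).
  by move=> T; rewrite mxE.
by do 2!(apply: polyfun_sum => ?); apply: pf_mul; [exact: pf_coord|].
Qed.

Lemma cov2map_d2 : cov2map (@d2 R).
Proof.
split; first exact: polyfun_d2.
by split=> [H /d2_sym//|g H [gg _] _]; exact: d2_act.
Qed.

Lemma cov2map_dd2 (f : T4 R -> 'M[R]_3) : cov2map f -> cov2map (fun T => dd2 T (f T)).
Proof.
case=> [pf [_ ef]]; split; first by move=> p q; exact: polyfun_dd2.
split=> [H /dd2_sym//|g H gS HH]; rewrite ef //; apply: dd2_act; exact: gS.1.
Qed.

Lemma Cov2_d2 H : Cov2 H (d2 H).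
Proof. by exists (@d2 R); split=> //; exact: cov2map_d2. Qed.

Lemma Cov2_c3 H : Cov2 H (c3 H).
Proof. by exists (@c3 R); split=> //; exact/cov2map_dd2/cov2map_d2. Qed.

Lemma Cov2_c4 H : Cov2 H (c4 H).
Proof. by exists (@c4 R); split=> //; exact/cov2map_dd2/cov2map_dd2/cov2map_d2. Qed.

Lemma symgrpT4P H g : symgrpT4 H g <-> SO3 g /\ act4 g H = H.
Proof. by split=> -[gS e]; split=> //; [exact: T4P | rewrite e]. Qed.

Lemma symgrpT4_Cov2 H g : inH4 H -> symgrpT4 H g -> symgrpSet (Cov2 H) g.
Proof.
move=> HH /symgrpT4P[gS e]; split=> // a [f [[_ [_ ef]] ->]].
by rewrite -ef // e.
Qed.

Lemma SO3_mulV g : SO3 g -> g *m g^T = 1%:M.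
Proof. by case=> /mulmx1C. Qed.

Lemma SO3_trmx g : SO3 g -> SO3 g^T.
Proof. by move=> gS; split; rewrite ?det_tr ?trmxK ?SO3_mulV //; exact: gS.2. Qed.

Lemma SO3_mul g h : SO3 g -> SO3 h -> SO3 (g *m h).
Proof.
move=> [gg dg] [hh dh]; split; last by rewrite det_mulmx dg dh mulr1.
by rewrite trmx_mul mulmxA -(mulmxA h^T) gg mulmx1.
Qed.

Lemma act2_mul g h a : act2 (g *m h) a = act2 g (act2 h a).
Proof. by rewrite /act2 trmx_mul !mulmxA. Qed.

Lemma act2_1 (a : 'M[R]_3) : act2 1%:M a = a.
Proof. by rewrite /act2 trmx1 mul1mx mulmx1. Qed.

Lemma act2K g : SO3 g -> cancel (act2 g) (act2 g^T).
Proof. by move=> gS a; rewrite -act2_mul gS.1 act2_1. Qed.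

Lemma act2KV g : SO3 g -> cancel (act2 g^T) (act2 g).
Proof. by move=> gS a; rewrite -act2_mul SO3_mulV // act2_1. Qed.

Lemma act4K g : SO3 g -> cancel (act4 g) (@act4 R g^T).
Proof. by move=> gS a; rewrite -act4_mul gS.1 act4_1. Qed.

Lemma act4KV g : SO3 g -> cancel (act4 g^T) (@act4 R g).
Proof. by move=> gS a; rewrite -act4_mul SO3_mulV // act4_1. Qed.

Lemma SO3_conj Q g : SO3 Q -> SO3 (Q *m g *m Q^T) <-> SO3 g.
Proof.
move=> QS; have QS' := SO3_trmx QS; split=> gS; last first.
  by apply: SO3_mul => //; exact: SO3_mul.
have -> : g = Q^T *m (Q *m g *m Q^T) *m Q by rewrite !mulmxA QS.1 mul1mx -mulmxA QS.1 mulmx1.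
by apply: SO3_mul => //; exact: SO3_mul.
Qed.

Lemma symgrpT4_conj Q H g : SO3 Q ->
  symgrpT4 H (Q *m g *m Q^T) <-> symgrpT4 (act4 Q^T H) g.
Proof.
move=> QS; split=> /symgrpT4P[gS e]; apply/symgrpT4P; split.
- by rewrite -(SO3_conj g QS).
- by apply: (can_inj (act4K QS)); rewrite (act4KV QS) -!act4_mul.
- by rewrite SO3_conj.
- by rewrite !act4_mul e act4KV.
Qed.

Lemma symgrpSet_conj Q (S S' : 'M[R]_3 -> Prop) g : SO3 Q ->
  (forall a, S' a <-> S (act2 Q a)) ->
  symgrpSet S (Q *m g *m Q^T) <-> symgrpSet S' g.
Proof.
move=> QS SS'; split=> -[gS e]; split.
- by rewrite -(SO3_conj g QS).
- move=> a /SS'/e; rewrite !act2_mul (act2K QS); exact: (can_inj (act2K QS)).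
- by rewrite SO3_conj.
- move=> a Sa; rewrite !act2_mul e ?(act2KV QS) //.
  by apply/SS'; rewrite (act2KV QS).
Qed.

Lemma Cov2_act Q H a : SO3 Q -> inH4 H -> Cov2 (act4 Q^T H) a <-> Cov2 H (act2 Q a).
Proof.
move=> QS HH; have QS' := SO3_trmx QS; split=> -[f [cf e]]; exists f; split=> //.
  by rewrite e (cf.2.2 Q^T) // act2KV.
by rewrite (cf.2.2 Q^T) // -e act2K.
Qed.

(** Moves the conjugation from [D2] to the group, which allows the argument to take place in a frame
    where the group is [D2] itself. *)
Lemma orthotropic_conj (G : 'M[R]_3 -> Prop) : orthotropic_grp G <->
  exists Q, SO3 Q /\ forall g, G (Q *m g *m Q^T) <-> D2 g.
Proof.
split=> -[Q [QS GQ]]; exists Q; split=> // g.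
- have K h : Q^T *m (Q *m h *m Q^T) *m Q = h.
    by rewrite !mulmxA QS.1 mul1mx -mulmxA QS.1 mulmx1.
  rewrite GQ; split=> [[d [dD e]]|gD]; last by exists g.
  by rewrite -(K g) e K.
- have K : Q *m (Q^T *m g *m Q) *m Q^T = g.
    by rewrite !mulmxA SO3_mulV // mul1mx -mulmxA SO3_mulV // mulmx1.
  rewrite -{1}K GQ; split=> [gD|[d [dD ->]]]; first by exists (Q^T *m g *m Q).
  by rewrite !mulmxA QS.1 mul1mx -mulmxA QS.1 mulmx1.
Qed.

End Components.

(** * The group D2 and coordinate rotations *)

Section Rotations.
Variable R : realType.
Implicit Types (g h : 'M[R]_3) (H T : T4 R).

Definition offdiag0 (a : 'M[R]_3) := forall p q, p != q -> a p q = 0.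

(** Two of four indices in a three-element set always agree, so for a symmetric tensor these are, up
    to order, all the components in which some index value occurs an odd number of times. *)
Definition oddfree H := forall m p q, p != q -> H m m p q = 0.

(** The last index of ['I_3] is written [1 + 1]. The explicit polynomial serves both the coordinate
    rotations and the continuity of the determinant. *)
Lemma det_mx33 (A : 'M[R]_3) : \det A =
  A 0 0 * (A 1 1 * A (1 + 1) (1 + 1) - A 1 (1 + 1) * A (1 + 1) 1)
  - A 0 1 * (A 1 0 * A (1 + 1) (1 + 1) - A 1 (1 + 1) * A (1 + 1) 0)
  + A 0 (1 + 1) * (A 1 0 * A (1 + 1) 1 - A 1 1 * A (1 + 1) 0).
Proof.
have E (x y : 'I_3) : val x = val y -> x = y by exact: val_inj.
rewrite (expand_det_row A 0) (@sum3 _ 0 1 (1 + 1)) // /cofactor !(expand_det_row _ 0).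
rewrite !big_ord_recl !big_ord0 /cofactor !det_mx11 !mxE /=.
rewrite (E (lift 0 (lift 0 0)) (1 + 1)) // (E (lift 0 0) 1) //.
rewrite (E (lift 1 (lift 0 0)) (1 + 1)) // (E (lift 1 0) 0) //.
rewrite (E (lift 0 (lift (lift ord0 ord0) 0)) 1) //.
rewrite (E (lift 1 (lift (lift ord0 ord0) 0)) 0) //.
rewrite (E (lift (1 + 1) ord0) 0) // (E (lift (1 + 1) (lift ord0 0)) 1) //.
rewrite (E (lift (1 + 1) (lift (lift ord0 ord0) 0)) 0) //.
have -> : (-1 : R) ^+ (0 + (1 %% 3 + 1 %% 3) %% 3) = 1 by rewrite /= sqrrN expr1n.
by rewrite expr0 !expr1; ring.
Qed.

(** The (p, q) entry of ab - ba is (a_pp - a_qq) b_pq when a is diagonal. *)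
Lemma offdiag0_comm (a b : 'M[R]_3) p q : offdiag0 a -> a *m b = b *m a ->
  a p p != a q q -> b p q = 0.
Proof.
move=> a0 ab apq; have /matrixP/(_ p q) := ab; rewrite !mxE (bigD1 p) //= [in RHS](bigD1 q) //=.
rewrite !big1 => [|r rq|r rp]; rewrite ?addr0.
- move=> /eqP; rewrite mulrC -subr_eq0 -mulrBr mulf_eq0 subr_eq0 (negPf apq) orbF.
  by move/eqP.
- by rewrite a0 // mulr0.
- by rewrite a0 1?eq_sym // mul0r.
Qed.

Lemma ap_offdiag0 g v i : offdiag0 g -> ap g v i = g i i * v i.
Proof.
move=> g0; rewrite /ap (bigD1 i) //= big1 ?addr0 // => j ji.
by rewrite g0 1?eq_sym // mul0r.
Qed.

Lemma act4_offdiag0 g H i j k l : offdiag0 g ->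
  act4 g H i j k l = g i i * g j j * g k k * g l l * H i j k l.
Proof. by move=> g0; rewrite act4E /slot1 /slot2 /slot3 /slot4 !ap_offdiag0 // !mulrA. Qed.

Lemma act2_offdiag0 g a i j : offdiag0 g -> act2 g a i j = g i i * g j j * a i j.
Proof. by move=> g0; rewrite act2_ap !ap_offdiag0 // !mulrA. Qed.

Lemma SO3_offdiag0_sqr g i : SO3 g -> offdiag0 g -> g i i * g i i = 1.
Proof.
move=> [gg _] g0; have /matrixP/(_ i i) := gg; rewrite !mxE eqxx (bigD1 i) //= big1.
  by rewrite mxE addr0.
by move=> j ji; rewrite mxE g0 ?mul0r.
Qed.

(** A diagonal rotation has entries 1 or -1 with product 1, which leaves four of the eight sign
    patterns. *)
Lemma D2_SO3 g : D2 g <-> SO3 g /\ offdiag0 g.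
Proof.
have diagS (s : 'rV[R]_3) : (forall i, s 0 i * s 0 i = 1) -> \prod_i s 0 i = 1 ->
    SO3 (diag_mx s) /\ offdiag0 (diag_mx s).
  move=> s1 ps; split; last by move=> p q pq; rewrite mxE (negPf pq).
  split; last by rewrite det_diag.
  rewrite tr_diag_mx; apply/matrixP => p q; rewrite mul_diag_mx !mxE.
  by have [->|] := eqVneq; rewrite ?mulr1n ?s1 // !mulr0n mulr0.
split.
  case=> [->|[->|[->|->]]]; last 3 first.
  1-3: apply: diagS; first (by move=> i; rewrite mxE; case: ifP => _; ring).
  1-3: by rewrite !big_ord_recl big_ord0 !mxE /=; ring.
  split; first by split; rewrite ?det1 // trmx1 mulmx1.
  by move=> p q pq; rewrite mxE (negPf pq).
move=> [gS g0].
have pm i : g i i = 1 \/ g i i = -1.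
  have /eqP := SO3_offdiag0_sqr i gS g0; rewrite -expr2 sqrf_eq1 => /orP[]/eqP; by [left|right].
have gd : g = diag_mx (\row_i g i i).
  apply/matrixP => p q; rewrite !mxE; have [->|/g0->] := eqVneq p q; by rewrite ?mulr1n.
have : \det g = 1 by exact: gS.2.
have u3 : uniq [:: 0; 1; 1 + 1 : 'I_3] by [].
rewrite {1}gd det_diag (bigD1 0) //= (bigD1 1) //= (bigD1 (1 + 1)) //= big_pred0; last first.
  by move=> m; case/or3P: (ord3_cases m u3) => /eqP->.
rewrite !mxE /D2; case: (pm 0) (pm 1) (pm (1 + 1)) => e0 [] e1 [] e2; rewrite e0 e1 e2 => pr.
- left; rewrite gd; apply/matrixP => p q; rewrite !mxE; congr (_ *+ _).
  by move: p; apply: (ord3_ind u3); rewrite ?e0 ?e1 ?e2.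
- by exfalso; clear gd; lra.
- by exfalso; clear gd; lra.
- right; left; rewrite {1}gd; congr diag_mx; apply/rowP; apply: (ord3_ind u3);
    by rewrite !mxE ?e0 ?e1 ?e2.
- by exfalso; clear gd; lra.
- right; right; left; rewrite {1}gd; congr diag_mx; apply/rowP; apply: (ord3_ind u3);
    by rewrite !mxE ?e0 ?e1 ?e2.
- do 3!right; rewrite {1}gd; congr diag_mx; apply/rowP; apply: (ord3_ind u3);
    by rewrite !mxE ?e0 ?e1 ?e2.
- by exfalso; clear gd; lra.
Qed.

Lemma D2_flip (p : 'I_3) :
  exists d : 'M[R]_3, D2 d /\ forall m, d m m = if m == p then 1 else -1.
Proof.
exists (diag_mx (\row_i (if i == p then 1 else -1))); split.
  right; move: p; apply: (@ord3_ind _ 0 1 (1 + 1)) => //;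
    by [left|right; left|right; right].
by move=> m; rewrite !mxE eqxx.
Qed.

Lemma D2_fix_offdiag0 (a : 'M[R]_3) :
  (forall d, D2 d -> act2 d a = a) <-> offdiag0 a.
Proof.
split=> [fa p q pq|a0 d /D2_SO3[dS d0]].
  have [d [dD dE]] := D2_flip p; have /D2_SO3[_ d0] := dD.
  have /matrixP/(_ p q) := fa d dD.
  by rewrite act2_offdiag0 // !dE eqxx eq_sym (negPf pq); lra.
apply/matrixP => p q; rewrite act2_offdiag0 //.
by have [->|/a0->] := eqVneq p q; rewrite ?mulr0 // SO3_offdiag0_sqr ?mul1r.
Qed.

(** The half-turn about axis p changes the sign of H_{mmpq}. Conversely, each component H_{ppqq} is
    multiplied by a product of squares of signs. *)
Lemma D2_fix_oddfree H : inH4 H ->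
  (forall d, D2 d -> act4 d H = H) <-> oddfree H.
Proof.
move=> HH; split=> [fH m p q pq|H0 d /D2_SO3[dS d0]].
  have [d [dD dE]] := D2_flip p; have /D2_SO3[dS d0] := dD.
  have : act4 d H m m p q = H m m p q by rewrite fH.
  by rewrite act4_offdiag0 // (SO3_offdiag0_sqr m dS d0) !dE eqxx eq_sym (negPf pq); lra.
have [s12 [s23 [s34 _]]] := HH.
have sq := SO3_offdiag0_sqr _ dS d0.
have pair p q : d p p * d p p * d q q * d q q * H p p q q = H p p q q.
  by rewrite sq mul1r sq mul1r.
apply: T4P => i j k l; rewrite act4_offdiag0 //.
have [->|ij] := eqVneq i j.
  by have [->|/H0->] := eqVneq k l; rewrite ?mulr0.
have [->|kl] := eqVneq k l; first by rewrite inH4_pairswap // H0 ?mulr0.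
have [ki|ki] := eqVneq k i.
  rewrite {}ki in kl *; rewrite s23; have [<-|/H0->] := eqVneq j l; rewrite ?mulr0 //.
  by rewrite -[RHS]pair; ring.
have [kj|kj] := eqVneq k j.
  rewrite {}kj in ki kl *; rewrite s12 s23; have [<-|/H0->] := eqVneq i l; rewrite ?mulr0 //.
  by rewrite -[RHS]pair; ring.
have u : uniq [:: i; j; k] by rewrite /= !inE negb_or ij eq_sym ki eq_sym kj.
case/or3P: (ord3_cases l u) => /eqP el; rewrite el.
- by rewrite s34 s23 H0 ?mulr0 // eq_sym.
- by rewrite s12 s34 s23 H0 ?mulr0 // eq_sym.
- by rewrite el eqxx in kl.
Qed.

(** Rotation in the plane of axes i and j, with [al] and [be] in the roles of cosine and sine;
    keeping them as plain numbers leaves every rotated component polynomial. *)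
Definition rot (i j : 'I_3) (al be : R) : 'M[R]_3 := \matrix_(p, q)
  if p == i then (if q == i then al else if q == j then - be else 0)
  else if p == j then (if q == i then be else if q == j then al else 0)
  else (p == q)%:R.

Section Rot.
Variables (i j k : 'I_3) (ijk : uniq [:: i; j; k]).

Lemma rotE al be : let g := rot i j al be in
  ((g i i = al) * (g i j = - be) * (g i k = 0)) *
  ((g j i = be) * (g j j = al) * (g j k = 0)) *
  ((g k i = 0) * (g k j = 0) * (g k k = 1)).
Proof.
have [ij ik jk] := uniq3P ijk.
have [ji ki kj] : [/\ (j == i) = false, (k == i) = false & (k == j) = false].
  by split; rewrite eq_sym; exact: negPf.
by rewrite /= !mxE !eqxx ji ki kj; do !split.
Qed.

Lemma rot_SO3 al be : al ^+ 2 + be ^+ 2 = 1 -> SO3 (rot i j al be).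
Proof.
move=> ab; split.
  apply/matrixP => p q; have [ij ik jk] := uniq3P ijk.
  have [ji ki kj] : [/\ j != i, k != i & k != j] by split; rewrite eq_sym.
  rewrite mxE (sum3 ijk) ![_^T _ _]mxE [RHS]mxE; move: p q.
  apply: (ord3_ind ijk) => q; move: q; apply: (ord3_ind ijk);
   rewrite !rotE ?eqxx ?(negPf ij, negPf ik, negPf jk, negPf ji, negPf ki, negPf kj) /=;
     first [ring | by rewrite -ab; ring].
rewrite det_mx33 /rot !mxE; move: ijk ab; clear ijk.
by case: i j k => [[|[|[|//]]] ?] [[|[|[|//]]] ?] [[|[|[|//]]] ?] //= _ ab; rewrite -[RHS]ab; ring.
Qed.

Lemma rot_notD2 al be : be != 0 -> ~ D2 (rot i j al be).
Proof.
move=> b0 /D2_SO3[_ /(_ j i)]; rewrite rotE => e; move/eqP: b0; apply; apply: e.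
by have [] := uniq3P (uniq3_swap ijk).
Qed.

End Rot.

Lemma inH4_eq H T (i j k : 'I_3) : uniq [:: i; j; k] -> inH4 H -> inH4 T ->
  H i i j j = T i i j j -> H i i k k = T i i k k -> H j j k k = T j j k k ->
  H i i i j = T i i i j -> H j j i j = T j j i j ->
  H i i i k = T i i i k -> H k k i k = T k k i k ->
  H j j j k = T j j j k -> H k k j k = T k k j k -> H = T.
Proof.
move=> ijk HH HT; rewrite !(sort_rules HH i j k, sort_rules HT i j k) => e1 e2 e3 e4 e5 e6 e7 e8 e9.
apply: T4P; apply: (ord3_ind ijk); apply: (ord3_ind ijk); apply: (ord3_ind ijk);
 apply: (ord3_ind ijk);
 by rewrite ?(sort_rules HH i j k, sort_rules HT i j k) ?(trace_rules HH ijk, trace_rules HT ijk)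
   ?e1 ?e2 ?e3 ?e4 ?e5 ?e6 ?e7 ?e8 ?e9.
Qed.

End Rotations.

(** * Symmetry groups of diagonal pairs and axial tensors *)

Section Symmetries.
Variable R : realType.
Implicit Types (g h : 'M[R]_3) (H T : T4 R).

Lemma rot90_fix_diag (a : 'M[R]_3) (i j k : 'I_3) : uniq [:: i; j; k] ->
  offdiag0 a -> a i i = a j j -> act2 (rot i j 0 1) a = a.
Proof.
move=> ijk a0 e; have [ij ik jk] := uniq3P ijk.
have [ji ki kj] : [/\ j != i, k != i & k != j] by split; rewrite eq_sym.
apply/matrixP => p q; rewrite act2_ap /ap !(sum3 ijk); move: p q.
apply: (ord3_ind ijk) => q; move: q; apply: (ord3_ind ijk);
  rewrite !(rotE ijk) ?(a0 i j, a0 i k, a0 j i, a0 j k, a0 k i, a0 k j) // ?e; ring.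
Qed.

Lemma offdiag0_act2 g (a : 'M[R]_3) p q : SO3 g -> offdiag0 a -> act2 g a = a ->
  a p p != a q q -> g p q = 0.
Proof.
move=> gS a0 e; apply: offdiag0_comm => //.
by rewrite -[in LHS]e /act2 -!mulmxA gS.1 mulmx1.
Qed.

(** If two axes carry the same eigenvalues of both x and z, a quarter-turn exchanging them fixes the
    pair. Otherwise a rotation fixing both commutes with both and must be diagonal. *)
Lemma pair_symgrp_D2 (x z : 'M[R]_3) :
  (forall g, symgrpSet (fun a => a = x \/ a = z) g <-> D2 g) <->
  [/\ offdiag0 x, offdiag0 z &
      forall p q, p != q -> ~ (x p p = x q q /\ z p p = z q q)].
Proof.
split=> [xzD|[x0 z0 sep] g].
  have x0 : offdiag0 x by apply/D2_fix_offdiag0 => d /xzD[_]; apply; left.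
  have z0 : offdiag0 z by apply/D2_fix_offdiag0 => d /xzD[_]; apply; right.
  split=> // p q pq [xpq zpq]; have [k pqk] := ord3_third pq.
  apply: (@rot_notD2 R p q k pqk 0 1); rewrite ?oner_eq0 //; apply/xzD; split.
    by apply: (rot_SO3 pqk); ring.
  by move=> a [->|->]; exact: rot90_fix_diag pqk _ _.
split=> [[gS gxz]|gD].
  apply/D2_SO3; split=> // p q pq.
  have [xpq|] := eqVneq (x p p) (x q q); last first.
    by apply: offdiag0_act2 => //; apply: gxz; left.
  have [zpq|] := eqVneq (z p p) (z q q); last first.
    by apply: offdiag0_act2 => //; apply: gxz; right.
  by case: (sep p q pq).
split; first by have /D2_SO3[] := gD.
by move=> a [->|->]; move: g gD; apply/D2_fix_offdiag0.
Qed.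

Section AxialTensor.
Variables (H : T4 R) (HH : inH4 H) (i j k : 'I_3) (ijk : uniq [:: i; j; k]).
(** Together the two hypotheses say that the matrix (H_{kkpq}) is invariant under all rotations
    about axis k. *)
Hypothesis kk0 : forall p q, p != q -> H k k p q = 0.
Hypothesis abE : H i i k k = H j j k k.

Lemma kk0_rules :
  (H i j k k = 0) * (H i k k k = 0) * (H j k k k = 0) *
  ((H i j j j = - H i i i j) * (H i j j k = - H i i i k) * (H i i j k = - H j j j k)).
Proof.
have [ij ik jk] := uniq3P ijk.
have := (kk0 ij, kk0 ik, kk0 jk).
rewrite !(sort_rules HH i j k) => -[[e1 e2] e3].
have := trace_rules HH ijk => -[_ [[t1 t2] t3]].
by do !split; rewrite ?t2 ?t3 //; lra.
Qed.

Lemma rot90_fix : H i i i k = 0 -> H j j j k = 0 -> symgrpT4 H (rot i j 0 1).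
Proof.
move=> q0 r0; have gS : SO3 (rot i j 0 1 : 'M[R]_3) by apply: (rot_SO3 ijk); ring.
apply/symgrpT4P; split=> //.
apply: (inH4_eq ijk) (inH4_act gS.1 HH) HH _ _ _ _ _ _ _ _ _;
  rewrite act4E /slot1 /slot2 /slot3 /slot4 /ap !(sum3 ijk) !(rotE ijk) !(mul0r, add0r, addr0,
    mul1r);
  rewrite ?(sort_rules HH i j k) ?(trace_rules HH ijk).1 ?kk0_rules ?q0 ?r0 ?abE; ring.
Qed.

Lemma rot120_fix be : be ^+ 2 = 3 / 4 -> H i i i j = 0 -> H i i k k + 4 * H i i j j = 0 ->
  symgrpT4 H (rot i j (-1/2) be).
Proof.
move=> b2 p0 ac; have gS : SO3 (rot i j (-1/2) be) by apply: (rot_SO3 ijk); rewrite b2; field.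
apply/symgrpT4P; split=> //.
(* The identities that depend on the value of [be] hold modulo be^2 - 3/4, and K is the cofactor
   supplied for each of them. *)
have E (x y K : R) : x - y = (be ^+ 2 - 3 / 4) * K -> x = y.
  by rewrite b2 subrr mul0r => /eqP; rewrite subr_eq0 => /eqP.
have aE : H j j k k = - (4 * H i i j j) by rewrite -abE; move: (H i i k k) (H i i j j) ac => x y;
  lra.
apply: (inH4_eq ijk) (inH4_act gS.1 HH) HH _ _ _ _ _ _ _ _ _;
  rewrite act4E /slot1 /slot2 /slot3 /slot4 /ap !(sum3 ijk) !(rotE ijk) !(mul0r, add0r, addr0,
    mul1r);
  rewrite ?(sort_rules HH i j k) ?(trace_rules HH ijk).1 ?kk0_rules ?p0 ?abE ?aE.
- by apply: (E _ _ (H i i j j * (be ^+ 2 + 5 / 4))); field.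
- by apply: (E _ _ (- (4 * H i i j j))); field.
- by apply: (E _ _ (- (4 * H i i j j))); field.
- by field.
- by field.
- by apply: (E _ _ (3 / 2 * H i i i k - be * H j j j k)); field.
- by field.
- by apply: (E _ _ (3 / 2 * H j j j k + be * H i i i k)); field.
- by field.
Qed.

Lemma rot_not_invol (al be : R) : al ^+ 2 + be ^+ 2 = 1 -> be != 0 ->
  rot i j al be *m rot i j al be <> 1%:M.
Proof.
move=> ab b0 /matrixP/(_ i i); rewrite !mxE (sum3 ijk) !(rotE ijk) eqxx /= => e.
have : be ^+ 2 = 0 by lra.
by move/eqP; rewrite sqrf_eq0 (negPf b0).
Qed.

(** Split H by weight under rotations about axis k. The hypotheses on H_{kkpq} remove weights 1 and
    2, leaving weights 0, 3 and 4. If weight 3 vanishes there is a symmetry of order 4, and if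
    weight 4 vanishes one of order 3. *)
Lemma axial_noninvolutive_sym : d2 H i k = 0 -> d2 H j k = 0 ->
  exists g, symgrpT4 H g /\ g *m g <> 1%:M.
Proof.
rewrite (d2_off HH (uniq3_rot (uniq3_swap ijk))).
rewrite (d2_off HH (uniq3_rot ijk)).
rewrite !(sort_rules HH i j k) !(trace_rules HH ijk).1 !kk0_rules !abE.
set a := H j j k k; set c := H i i j j; set p := H i i i j; set q := H i i i k.
set r := H j j j k => e1 e2.
(* These are the real and imaginary parts of (q + ir)(a + 4c - 4ip) = 0, a product of the weight 3
   and weight 4 components; one factor must vanish. *)
have E1 : q * (a + 4 * c) + 4 * (p * r) = 0 by lra.
have E2 : r * (a + 4 * c) - 4 * (p * q) = 0 by lra.
have [q2r2|qr] := eqVneq (q ^+ 2 + r ^+ 2) 0.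
  have /eqP : q ^+ 2 == 0 by apply/eqP; have := sqr_ge0 q; have := sqr_ge0 r; lra.
  have /eqP : r ^+ 2 == 0 by apply/eqP; have := sqr_ge0 q; have := sqr_ge0 r; lra.
  move=> /eqP; rewrite sqrf_eq0 => /eqP r0 /eqP; rewrite sqrf_eq0 => /eqP q0.
  exists (rot i j 0 1); split; first exact: rot90_fix.
  by apply: rot_not_invol; [ring|exact: oner_neq0].
have p0 : p = 0.
  apply/eqP; rewrite -(mulIr_eq0 _ (mulIf qr)); apply/eqP.
  have := congr2 (fun x y => r * x - q * y) E1 E2; rewrite /=; lra.
have ac : a + 4 * c = 0.
  apply/eqP; rewrite -(mulIr_eq0 _ (mulIf qr)); apply/eqP.
  have := congr2 (fun x y => q * x + r * y) E1 E2; rewrite /=; lra.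
have s3 : (Num.sqrt 3 / 2 : R) ^+ 2 = 3 / 4.
  by rewrite expr_div_n sqr_sqrtr //; field.
exists (rot i j (-1/2) (Num.sqrt 3 / 2)); split.
  by apply: rot120_fix => //; rewrite abE.
apply: rot_not_invol; first by rewrite s3; field.
by rewrite mulf_neq0 ?invr_eq0 ?pnatr_eq0 // sqrtr_eq0 -ltNge ltr0n.
Qed.

End AxialTensor.
End Symmetries.

(** * The case of dependent d2, c3 and identity *)

Section Eigen.
Variable R : realType.
Implicit Types (B C u v w y : R).

Definition elem2 y1 y2 y3 := y1 * y2 + y2 * y3 + y3 * y1.

(* With a = B y2 y3 + C, b = B y1 y3 + C, c = B y1 y2 + C and H_{mm12} = u y_m,
   H_{mm13} = v y_m, H_{mm23} = w y_m, this is y3 = d2_{11} - d2_{22} divided by y3. *)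
Definition gap_eq B C u v w y1 y2 y3 :=
  (y1 - y2) * (B * (10 * C + 2 * B * elem2 y1 y2 y3 - 2 * B * y3 ^+ 2)
               - 2 * u ^+ 2 - 3 * v ^+ 2 - 3 * w ^+ 2) + y3 * (v ^+ 2 - w ^+ 2) = 1.

(** Both gap equations have right-hand side 1; modulo y1 + y2 + y3 = 0 the difference of their
    left-hand sides is a multiple of y2. *)
Lemma norm_uvw B C u v w y1 y2 y3 : y1 + y2 + y3 = 0 -> y2 != 0 ->
  gap_eq B C u v w y1 y2 y3 -> gap_eq B C w u v y2 y3 y1 ->
  4 * (u ^+ 2 + v ^+ 2 + w ^+ 2) = B * (15 * C + 4 * B * elem2 y1 y2 y3).
Proof.
move=> y0 y2n D3 D1; apply: (mulIf y2n); have -> : y3 = - (y1 + y2) by lra.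
have y3E : y3 = - (y1 + y2) by lra.
move: D3 D1; rewrite /gap_eq /elem2 y3E => D3 D1.
have := congr2 (fun a b => a - b) D1 D3 => /=; lra.
Qed.

(** The off-diagonal equation determines C, then [norm_uvw] determines u^2; with these values the
    left-hand side of the gap equation is 0 instead of 1. *)
Lemma only_u_absurd B C u y1 y2 y3 : y1 + y2 + y3 = 0 -> y2 != 0 -> u != 0 ->
  u * (5 * C - 4 * B * y3 ^+ 2) = 0 ->
  gap_eq B C u 0 0 y1 y2 y3 -> gap_eq B C 0 u 0 y2 y3 y1 -> False.
Proof.
move=> y0 y2n un /eqP; rewrite mulf_eq0 (negPf un) /= subr_eq0 => /eqP CE D3 D1.
have := norm_uvw y0 y2n D3 D1; move: D3; rewrite /gap_eq expr0n /= => D3 N.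
have u2 : u ^+ 2 = B * (B * (3 * y3 ^+ 2 + elem2 y1 y2 y3)).
  have -> : B * (B * (3 * y3 ^+ 2 + elem2 y1 y2 y3)) =
    B * (3 * (4 * B * y3 ^+ 2) + 4 * B * elem2 y1 y2 y3) / 4 by field.
  by rewrite -CE; lra.
have : (1 : R) = 0.
  rewrite -D3 (_ : 10 * C = 2 * (5 * C)); last by ring.
  by rewrite CE u2; ring.
by move/eqP; rewrite oner_eq0.
Qed.

(** Multiplying the off-diagonal equations in pairs expresses u^2, v^2 and w^2 through B, C and the
    y's. Substituted into the gap equation times y1 y2, they give y1 y2 = 0. *)
Lemma all_uvw_absurd B C u v w y1 y2 y3 :
  y1 + y2 + y3 = 0 -> y1 != 0 -> y2 != 0 -> B != 0 -> u * v * w != 0 ->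
  u * (5 * C - 4 * B * y3 ^+ 2) + 4 * (v * w * y3) = 0 ->
  w * (5 * C - 4 * B * y1 ^+ 2) + 4 * (u * v * y1) = 0 ->
  v * (5 * C - 4 * B * y2 ^+ 2) + 4 * (w * u * y2) = 0 ->
  gap_eq B C u v w y1 y2 y3 -> gap_eq B C w u v y2 y3 y1 -> False.
Proof.
move=> y0 y1n y2n Bn; rewrite !mulf_eq0 !negb_or -andbA => /and3P[un vn wn] F12 F23 F31 D3 D1.
have N := norm_uvw y0 y2n D3 D1.
(* Chosen so that 5C - 4B y^2 = 4B (k - y^2). *)
pose k := 5 * C / (4 * B); have CE : C = 4 * B * k / 5 by rewrite /k; field.
rewrite CE in F12 F23 F31 N D3.
have f12 : v * w * y3 = u * (B * (y3 ^+ 2 - k)) by lra.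
have f23 : u * v * y1 = w * (B * (y1 ^+ 2 - k)) by lra.
have f31 : w * u * y2 = v * (B * (y2 ^+ 2 - k)) by lra.
have U : u ^+ 2 * (y1 * y2) = B ^+ 2 * ((y1 ^+ 2 - k) * (y2 ^+ 2 - k)).
  apply: (mulIf vn); apply: (mulIf wn).
  have := congr2 (fun a b => a * b) f23 f31 => /=; lra.
have V : v ^+ 2 * (y1 * y3) = B ^+ 2 * ((y1 ^+ 2 - k) * (y3 ^+ 2 - k)).
  apply: (mulIf un); apply: (mulIf wn).
  have := congr2 (fun a b => a * b) f23 f12 => /=; lra.
have W : w ^+ 2 * (y2 * y3) = B ^+ 2 * ((y2 ^+ 2 - k) * (y3 ^+ 2 - k)).
  apply: (mulIf un); apply: (mulIf vn).
  have := congr2 (fun a b => a * b) f31 f12 => /=; lra.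
have D : (y1 - y2) * (B ^+ 2 * (- k - elem2 y1 y2 y3 - 2 * y3 ^+ 2) + u ^+ 2)
         + y3 * (v ^+ 2 - w ^+ 2) = 1.
  rewrite -[RHS]D3 (_ : _ - 2 * u ^+ 2 - 3 * v ^+ 2 - 3 * w ^+ 2 =
    B * (10 * (4 * B * k / 5) + 2 * B * elem2 y1 y2 y3 - 2 * B * y3 ^+ 2)
    + u ^+ 2 - 3 / 4 * (4 * (u ^+ 2 + v ^+ 2 + w ^+ 2))); last by field.
  by rewrite N; field.
have : y1 * y2 = 0.
  transitivity ((y1 - y2) * (B ^+ 2 * (- k - elem2 y1 y2 y3 - 2 * y3 ^+ 2) * (y1 * y2)
     + u ^+ 2 * (y1 * y2)) + y2 * (v ^+ 2 * (y1 * y3)) - y1 * (w ^+ 2 * (y2 * y3))).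
    by rewrite -[LHS]mulr1 -[X in _ * X = _]D; ring.
  by rewrite U V W /elem2 (_ : y3 = - (y1 + y2)); [ring | lra].
by move/eqP; rewrite mulf_eq0 (negPf y1n) (negPf y2n).
Qed.

(** If B = 0, [norm_uvw] is a vanishing sum of squares. Otherwise the number of zeros among u, v, w
    decides: a single zero leaves a nonzero product in its off-diagonal equation, and the cases of
    two zeros and of none are the two preceding lemmas, up to a cyclic shift. *)
Lemma uvw_eq0 B C u v w y1 y2 y3 :
  y1 + y2 + y3 = 0 -> y1 != 0 -> y2 != 0 -> y3 != 0 ->
  u * (5 * C - 4 * B * y3 ^+ 2) + 4 * (v * w * y3) = 0 ->
  w * (5 * C - 4 * B * y1 ^+ 2) + 4 * (u * v * y1) = 0 ->
  v * (5 * C - 4 * B * y2 ^+ 2) + 4 * (w * u * y2) = 0 ->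
  gap_eq B C u v w y1 y2 y3 -> gap_eq B C w u v y2 y3 y1 -> gap_eq B C v w u y3 y1 y2 ->
  [/\ u = 0, v = 0 & w = 0].
Proof.
move=> y0 y1n y2n y3n F12 F23 F31 D3 D1 D2.
have N := norm_uvw y0 y2n D3 D1.
have [B0|Bn] := eqVneq B 0.
  rewrite B0 mul0r in N.
  have s0 (t : R) : t ^+ 2 <= 0 -> t = 0.
    by move=> t0; apply/eqP; rewrite -sqrf_eq0 eq_le t0 sqr_ge0.
  by split; apply: s0; have := (sqr_ge0 u, sqr_ge0 v, sqr_ge0 w) => -[[]]; lra.
have [m0|mn] := eqVneq (u * v * w) 0;
  last by case: (all_uvw_absurd y0 y1n y2n Bn mn F12 F23 F31 D3 D1).
have cyc0 : y2 + y3 + y1 = 0 by lra.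
have cyc1 : y3 + y1 + y2 = 0 by lra.
have [u0|un] := eqVneq u 0; [have [v0|vn] := eqVneq v 0; [have [w0|wn] := eqVneq w 0|]|].
- by [].
- case: (@only_u_absurd B C w y2 y3 y1 cyc0 y3n wn).
  + by rewrite u0 in F23; rewrite -F23; ring.
  + by rewrite u0 v0 in D1.
  + by rewrite u0 v0 in D2.
- have w0 : w = 0.
    apply/eqP; have /eqP := F12;
      rewrite u0 mul0r add0r !mulf_eq0 pnatr_eq0 /= (negPf vn) (negPf y3n).
    by rewrite /= orbF.
  case: (@only_u_absurd B C v y3 y1 y2 cyc1 y1n vn).
  + by rewrite u0 w0 in F31; rewrite -F31; ring.
  + by rewrite u0 w0 in D2.
  + by rewrite u0 w0 in D3.
have [v0|vn] := eqVneq v 0.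
  have w0 : w = 0.
    apply/eqP; have /eqP := F31;
      rewrite v0 mul0r add0r !mulf_eq0 pnatr_eq0 /= (negPf un) (negPf y2n).
    by rewrite !orbF.
  case: (@only_u_absurd B C u y1 y2 y3 y0 y2n un).
  + by rewrite v0 w0 in F12; rewrite -F12; ring.
  + by rewrite v0 w0 in D3.
  + by rewrite v0 w0 in D1.
have w0 : w = 0.
  by apply/eqP; move/eqP: m0; rewrite !mulf_eq0 (negPf un) (negPf vn).
have /eqP := F23; rewrite w0 mul0r add0r !mulf_eq0 pnatr_eq0 /= (negPf un) (negPf vn).
by rewrite (negPf y1n).
Qed.

Lemma affine_param (a b c : R) y1 y2 y3 : y1 + y2 + y3 = 0 -> y2 != 0 -> y3 != 0 ->
  (b * y2 - c * y3) * y1 + (c * y3 - a * y1) * y2 + (a * y1 - b * y2) * y3 = 0 ->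
  exists C B, [/\ a = B * (y2 * y3) + C, b = B * (y1 * y3) + C & c = B * (y1 * y2) + C].
Proof.
move=> y0 y2n y3n G0.
(* C is found by requiring (a - C) y1 = (b - C) y2 = (c - C) y3; B is then this common value divided
   by y1 y2 y3. *)
have [C e1] : exists C, b * y2 + a * y1 - 2 * (c * y3) = - (3 * C * y3).
  by exists (- ((b * y2 + a * y1 - 2 * (c * y3)) / y3) / 3); field.
have y2E : y2 = - (y1 + y3) by lra.
have e2 : c * y3 + b * y2 - 2 * (a * y1) = - (3 * C * y1).
  apply: (mulIf y3n); rewrite [RHS](_ : _ = - (3 * C * y3) * y1 - 0); last by ring.
  by rewrite -e1 -G0 y2E; ring.
have y2C : C * y2 = - (C * y1) - C * y3 by rewrite y2E; ring.
have eb : (b - C) * y2 = (a - C) * y1 by lra.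
have ec : (c - C) * y3 = (a - C) * y1 by lra.
exists C, ((a - C) / (y2 * y3)); split; first by field; rewrite y2n y3n.
- by apply/eqP; rewrite -subr_eq; apply/eqP; apply: (mulIf y2n); rewrite eb; field; rewrite y2n y3n.
- by apply/eqP; rewrite -subr_eq; apply/eqP; apply: (mulIf y3n); rewrite ec; field; rewrite y2n y3n.
Qed.

End Eigen.

(** * Vanishing of the odd components when the covariants commute *)

Section OddFree.
Variables (R : realType) (H : T4 R) (HH : inH4 H).
Hypothesis d0 : offdiag0 (d2 H).
Hypothesis z0 : offdiag0 (c3 H).
Hypothesis sep : forall p q, p != q -> ~ (d2 H p p = d2 H q q /\ c3 H p p = c3 H q q).
Hypothesis comm : d2 H *m c4 H = c4 H *m d2 H.

Let x (m : 'I_3) : R := d2 H m m.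
Let z (m : 'I_3) : R := c3 H m m.

Lemma c3_entry i j k p q : uniq [:: i; j; k] ->
  c3 H p q = H i i p q * x i + H j j p q * x j + H k k p q * x k.
Proof. by move=> ijk; exact: (dd2_diag HH ijk d0). Qed.

Lemma c4_entry i j k p q : uniq [:: i; j; k] ->
  c4 H p q = H i i p q * z i + H j j p q * z j + H k k p q * z k.
Proof. by move=> ijk; exact: (dd2_diag HH ijk z0). Qed.

Lemma trace_entry i j k p q : uniq [:: i; j; k] ->
  H i i p q + H j j p q + H k k p q = 0.
Proof. by move=> ijk; rewrite -(sum3 ijk (fun m => H m m p q)); exact: HH.2.2.2. Qed.

Lemma c4_comm p q : x p != x q -> c4 H p q = 0.
Proof. exact: offdiag0_comm. Qed.

(** Up to sign, the determinant with rows (1, 1, 1), x and z. *)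
Definition planar i j k := z i * (x j - x k) + z j * (x k - x i) + z k * (x i - x j).

(** The trace condition and the vanishing of the (p, q) entries of c3 and c4 are three linear
    equations for (H_{mmpq})_m with determinant [planar] up to sign; Cramer's rule applies. *)
Lemma planar_kill i j k m p q : uniq [:: i; j; k] -> planar i j k != 0 ->
  p != q -> x p != x q -> H m m p q = 0.
Proof.
move=> ijk Gn pq xpq.
have := trace_entry p q ijk; have := z0 pq; have := c4_comm xpq.
rewrite (c3_entry _ _ ijk) (c4_entry _ _ ijk) => hz hx h1.
have kill (h : R) : h * planar i j k = 0 -> h = 0.
  by move/eqP; rewrite mulf_eq0 (negPf Gn) orbF => /eqP.
move: m; apply: (ord3_ind ijk); apply: kill; rewrite /planar.
- have := congr2 (fun a b => a + b) (congr1 (fun t => t * (x j * z k - x k * z j)) h1)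
   (congr2 (fun a b => a + b) (congr1 (fun t => t * (z j - z k)) hx) (congr1 (fun t => t * (x k -
     x j)) hz)).
  rewrite /=; lra.
- have := congr2 (fun a b => a + b) (congr1 (fun t => t * (x k * z i - x i * z k)) h1)
   (congr2 (fun a b => a + b) (congr1 (fun t => t * (z k - z i)) hx) (congr1 (fun t => t * (x i -
     x k)) hz)).
  rewrite /=; lra.
- have := congr2 (fun a b => a + b) (congr1 (fun t => t * (x i * z j - x j * z i)) h1)
   (congr2 (fun a b => a + b) (congr1 (fun t => t * (z i - z j)) hx) (congr1 (fun t => t * (x j -
     x i)) hz)).
  rewrite /=; lra.
Qed.

Lemma c3_const i j k : uniq [:: i; j; k] -> x i = x j -> x j = x k -> forall m, z m = 0.
Proof.
move=> ijk xij xjk m; rewrite /z (c3_entry _ _ ijk) xij xjk -!mulrDl.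
by rewrite (trace_entry _ _ ijk) mul0r.
Qed.

(** Only a double eigenvalue x_p = x_q escapes [planar_kill]. Then the trace and c3 give H_{rrpq} =
    0, and d2_{pq} = 0 becomes H_{pppq} times a factor that is nonzero because z_p and z_q
    differ. *)
Lemma planar_neq0_oddfree i j k : uniq [:: i; j; k] -> planar i j k != 0 -> oddfree H.
Proof.
move=> ijk Gn m p q pq.
have [xpq|xpq] := eqVneq (x p) (x q); last exact: planar_kill ijk Gn pq xpq.
have [r pqr] := ord3_third pq; have [_ pr qr] := uniq3P pqr.
have xqr : x q != x r.
  apply/eqP => xqr; have zc := c3_const pqr xpq xqr.
  by move/eqP: Gn; rewrite /planar !zc !mul0r !addr0.
have xpr : x p != x r by rewrite xpq.
have kpr := planar_kill _ ijk Gn pr xpr; have kqr := planar_kill _ ijk Gn qr xqr.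
have h1 := trace_entry p q pqr; have hx := z0 pq; rewrite (c3_entry _ _ pqr) xpq in hx.
have hr : H r r p q = 0.
  have /eqP : H r r p q * (x r - x q) = 0.
    by have := congr1 (fun t => t * x q) h1 => /=; lra.
  by rewrite mulf_eq0 subr_eq0 [x r == _]eq_sym (negPf xqr) orbF => /eqP.
have hq : H q q p q = - H p p p q by lra.
have hp : H p p p q = 0.
  have zd : z p - z q = (H p p r r - H q q r r) * (x r - x q).
    rewrite /z !(c3_entry _ _ pqr) xpq !(sort_rules HH p q r) !(trace_rules HH pqr).1; ring.
  have abn : H q q r r - H p p r r != 0.
    apply/eqP => e; case: (sep pq); split=> //; apply/eqP; rewrite -subr_eq0 -/(z p) -/(z q) zd.
    by rewrite -opprB e oppr0 mul0r.
  have := d0 pq; rewrite (d2_off HH pqr) hr hq !kpr !kqr (trace_rules HH pqr).1.1.1.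
  rewrite (trace_rules HH pqr).1.1.2 => e.
  apply: (mulIf abn); rewrite mul0r -[RHS]e; ring.
by move: m; apply: (ord3_ind pqr); rewrite ?hq ?hp ?oppr0.
Qed.

(** For x_i = x_j the determinant factors as (x_j - x_k)(z_i - z_j); if the first factor vanishes,
    d2 is spherical and z = 0. *)
Lemma planar_eq0_simple i j k : uniq [:: i; j; k] -> planar i j k = 0 -> x i != x j.
Proof.
move=> ijk G0; have [ij _ _] := uniq3P ijk; apply/eqP => xij.
have /eqP : (x j - x k) * (z i - z j) = 0 by move: G0; rewrite /planar xij => <-; ring.
rewrite mulf_eq0 !subr_eq0 => /orP[]/eqP e; apply: (sep ij); split=> //.
by rewrite -/(z i) -/(z j) !(c3_const ijk xij e).
Qed.

Lemma planar_eq0_oddfree i j k : uniq [:: i; j; k] -> planar i j k = 0 -> oddfree H.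
Proof.
move=> ijk G0; have jki := uniq3_rot ijk; have kij := uniq3_rot jki.
have [ij ik jk] := uniq3P ijk.
have y3n : x i - x j != 0 by rewrite subr_eq0; exact: planar_eq0_simple ijk G0.
have y1n : x j - x k != 0.
  by rewrite subr_eq0; apply: (planar_eq0_simple jki); rewrite -G0 /planar; ring.
have y2n : x k - x i != 0.
  by rewrite subr_eq0; apply: (planar_eq0_simple kij); rewrite -G0 /planar; ring.
set y3 := x i - x j in y3n; set y1 := x j - x k in y1n; set y2 := x k - x i in y2n.
have y0 : y1 + y2 + y3 = 0 by rewrite /y1 /y2 /y3; ring.
(* A vector orthogonal to both (1, 1, 1) and x is a multiple of their cross product, that is, of
   (y1, y2, y3). *)
have offE p q : p != q -> exists u,
    [/\ H i i p q = u * y1, H j j p q = u * y2 & H k k p q = u * y3].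
  move=> pq; have h1 := trace_entry p q ijk; have hx := z0 pq.
  rewrite (c3_entry _ _ ijk) in hx; exists (H k k p q / y3).
  split; last by rewrite mulfVK.
  - apply: (mulIf y3n); rewrite mulrAC mulfVK //.
    have := congr1 (fun t => t * x j) h1; rewrite /y1 /y3 /=; lra.
  - apply: (mulIf y3n); rewrite mulrAC mulfVK //.
    have := congr1 (fun t => t * x i) h1; rewrite /y2 /y3 /=; lra.
have [u [ui uj uk]] := offE _ _ ij; have [v [vi vj vk]] := offE _ _ ik.
have [w [wi wj wk]] := offE _ _ jk.
set a := H j j k k; set b := H i i k k; set c := H i i j j.
have zi : z i = b * y2 - c * y3.
  by rewrite /z (c3_entry _ _ ijk) ?(sort_rules HH i j k) (trace_rules HH ijk).1.1.1 /y2 /y3 /b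
    /c; ring.
have zj : z j = c * y3 - a * y1.
  by rewrite /z (c3_entry _ _ ijk) ?(sort_rules HH i j k) (trace_rules HH ijk).1.1.2 /y1 /y3 /a
    /c; ring.
have zk : z k = a * y1 - b * y2.
  by rewrite /z (c3_entry _ _ ijk) ?(sort_rules HH i j k) (trace_rules HH ijk).1.2 /y1 /y2 /a /b;
    ring.
have [C [B [aE bE cE]]] : exists C B,
    [/\ a = B * (y2 * y3) + C, b = B * (y1 * y3) + C & c = B * (y1 * y2) + C].
  apply: affine_param => //; rewrite -zi -zj -zk; exact: G0.
have S := sort_rules HH i j k; have T := (trace_rules HH ijk).1.
have F12 := d0 ij; rewrite (d2_off HH ijk) in F12.
have F23 := d0 jk; rewrite (d2_off HH jki) in F23.
have F31 := d0 ik; rewrite (d2_off HH (uniq3_rot (uniq3_swap ijk))) in F31.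
have Di := d2_diag HH ijk; have Dj := d2_diag HH jki; have Dk := d2_diag HH kij.
rewrite !S !T -/a -/b -/c in F12 F23 F31 Di Dj Dk.
rewrite !S in ui uj uk vi vj vk wi wj wk.
rewrite !(ui, uj, uk, vi, vj, vk, wi, wj, wk) aE bE cE in F12 F23 F31 Di Dj Dk.
(* The six conditions are the off-diagonal entries of d2 and the differences of its diagonal
   entries, each divided by a nonzero y. *)
have [] := @uvw_eq0 R B C u v w y1 y2 y3 y0 y1n y2n y3n.
- apply: (mulIf y3n); rewrite mul0r -[RHS]F12 (_ : y2 = - (y1 + y3)); [ring|lra].
- apply: (mulIf y1n); rewrite mul0r -[RHS]F23 (_ : y2 = - (y1 + y3)); [ring|lra].
- apply: (mulIf y2n); rewrite mul0r -[RHS]F31 (_ : y2 = - (y1 + y3)); [ring|lra].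
- rewrite /gap_eq /elem2; apply: (mulIf y3n);
    rewrite mul1r [RHS](_ : y3 = d2 H i i - d2 H j j) // Di Dj.
  rewrite (_ : y2 = - (y1 + y3)); [ring|lra].
- rewrite /gap_eq /elem2; apply: (mulIf y1n);
    rewrite mul1r [RHS](_ : y1 = d2 H j j - d2 H k k) // Dj Dk.
  rewrite (_ : y2 = - (y1 + y3)); [ring|lra].
- rewrite /gap_eq /elem2; apply: (mulIf y2n);
    rewrite mul1r [RHS](_ : y2 = d2 H k k - d2 H i i) // Dk Di.
  rewrite (_ : y2 = - (y1 + y3)); [ring|lra].
move=> u0 v0 w0.
have sym m p q : H m m p q = H m m q p by exact: HH.2.2.1.
move=> m p q; move: p q m; apply: (ord3_ind ijk) => q; move: q; apply: (ord3_ind ijk) => m;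
  rewrite ?eqxx // => _; move: m; apply: (ord3_ind ijk);
  by rewrite ?S ?(ui, uj, uk, vi, vj, vk, wi, wj, wk) ?u0 ?v0 ?w0 mul0r.
Qed.

Lemma covariants_oddfree : oddfree H.
Proof.
have u3 : uniq [:: 0; 1; 1 + 1 : 'I_3] by [].
have [G0|Gn] := eqVneq (planar 0 1 (1 + 1)) 0; first exact: planar_eq0_oddfree u3 G0.
exact: planar_neq0_oddfree u3 Gn.
Qed.

End OddFree.

(** * An extremal frame *)

Section Maximum.
Variable R : realType.
Implicit Types (g h : 'M[R]_3) (H T : T4 R).
Local Open Scope classical_set_scope.

(* Matrices are flattened because bounded_closed_compact is about row vectors. *)
Definition cont9 (f : 'M[R]_3 -> R) :=
  continuous (fun v : 'rV[R]_(3 * 3) => f (vec_mx v)).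

Lemma cont9_cst c : cont9 (fun=> c).
Proof. exact: cst_continuous. Qed.

Lemma cont9_entry p q : cont9 (fun g => g p q).
Proof.
rewrite /cont9; under eq_fun do rewrite mxE; exact: coord_continuous.
Qed.

Lemma cont9D f1 f2 : cont9 f1 -> cont9 f2 -> cont9 (fun g => f1 g + f2 g).
Proof. by move=> c1 c2 v; apply: continuousD; [exact: c1|exact: c2]. Qed.

Lemma cont9M f1 f2 : cont9 f1 -> cont9 f2 -> cont9 (fun g => f1 g * f2 g).
Proof. by move=> c1 c2 v; apply: continuousM; [exact: c1|exact: c2]. Qed.

Lemma cont9N f : cont9 f -> cont9 (fun g => - f g).
Proof. by move=> cf v; apply: continuousN; exact: cf. Qed.

Lemma cont9_sum (F : 'I_3 -> 'M[R]_3 -> R) :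
  (forall m, cont9 (F m)) -> cont9 (fun g => \sum_m F m g).
Proof.
move=> cF; have u3 : uniq [:: 0; 1; 1 + 1 : 'I_3] by [].
rewrite (_ : (fun g => _) = fun g => F 0 g + F 1 g + F (1 + 1) g).
  by apply: cont9D => //; apply: cont9D.
by apply/funext => g; rewrite (sum3 u3).
Qed.

Lemma cont9_closed f c : cont9 f -> closed [set v | f (vec_mx v) = c].
Proof.
move=> cf; have /continuous_closedP/(_ [set x : R | x = c]) := cf.
by apply; exact: closed_eq.
Qed.

Lemma cont9_act4 H i j k l : cont9 (fun g => act4 g H i j k l).
Proof.
do 4!(apply: cont9_sum => ?); apply: cont9M; last exact: cont9_cst.
by do 3!(apply: cont9M; last exact: cont9_entry); exact: cont9_entry.
Qed.

Lemma closed_SO3 : closed [set v : 'rV[R]_(3 * 3) | SO3 (vec_mx v)].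
Proof.
rewrite (_ : [set v | _] = \bigcap_(p in [set: 'I_3 * 'I_3])
   [set v | ((vec_mx v)^T *m vec_mx v) p.1 p.2 = (p.1 == p.2)%:R]
   `&` [set v | \det (vec_mx v) = 1]); last first.
  apply/seteqP; split=> v /=.
    by move=> [gg dg]; split=> // -[p q] _ /=; rewrite gg mxE.
  move=> [gg dg]; split=> //; apply/matrixP => p q; rewrite [RHS]mxE.
  exact: (gg (p, q)).
apply: closedI.
  apply: closed_bigI => -[p q] _ /=; apply: (@cont9_closed (fun g => (g^T *m g) p q)).
  rewrite (_ : (fun g => _) = fun g => \sum_r g r p * g r q).
    by apply: cont9_sum => r; apply: cont9M; exact: cont9_entry.
  by apply/funext => g; rewrite mxE; apply: eq_bigr => r _; rewrite mxE.
apply: (@cont9_closed (fun g => \det g)).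
have -> : (fun g : 'M[R]_3 => \det g) = _ := funext (@det_mx33 R).
by do ![exact: cont9_entry | apply: cont9M | apply: cont9N | apply: cont9D].
Qed.

Lemma SO3_entry_le1 g p q : SO3 g -> `|g p q| <= 1.
Proof.
move=> [gg _]; have /matrixP/(_ q q) := gg; rewrite !mxE eqxx (bigD1 p) //= mxE => e.
rewrite -(@ler_pXn2r _ 2) ?nnegrE // expr1n real_normK ?num_real //.
rewrite -[leRHS]e expr2 lerDl sumr_ge0 // => r _.
by rewrite mxE -expr2 sqr_ge0.
Qed.

Lemma compact_SO3 : compact [set v : 'rV[R]_(3 * 3) | SO3 (vec_mx v)].
Proof.
apply: bounded_closed_compact; last exact: closed_SO3.
exists 1; split; first exact: num_real.
move=> M /ltW M1 v /= vS; rewrite /Num.Def.normr /= mx_normrE.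
apply: bigmax_le => [|[a b] _ /=]; first exact: le_trans ler01 M1.
apply: le_trans M1; rewrite ord1.
case/mxvec_indexP: b => p q.
have := SO3_entry_le1 p q vS; by rewrite mxE.
Qed.

(** The constraint P makes it possible to maximise a second function among the maximisers of a
    first. *)
Lemma SO3_max (f : 'M[R]_3 -> R) (P : 'M[R]_3 -> Prop) :
  cont9 f -> closed [set v : 'rV[R]_(3 * 3) | P (vec_mx v)] -> (exists g, SO3 g /\ P g) ->
  exists g, [/\ SO3 g, P g & forall h, SO3 h -> P h -> f h <= f g].
Proof.
move=> cf cP [g0 [g0S Pg0]].
set K := [set v : 'rV[R]_(3 * 3) | SO3 (vec_mx v)] `&` [set v | P (vec_mx v)].
have cK : compact K.
  by apply: (subclosed_compact _ compact_SO3); [exact: closedI closed_SO3 cP | exact: subIsetl].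
have K0 : K !=set0 by exists (mxvec g0); split; rewrite /= mxvecK.
have [v /set_mem[vS Pv] vmax] := EVT_max_rV K0 cK (continuous_subspaceT cf).
exists (vec_mx v); split=> // h hS Ph.
by rewrite -[h in f h]mxvecK; apply: vmax; apply/mem_set; split; rewrite /= mxvecK.
Qed.

End Maximum.

(** * First-order conditions at a maximal frame *)

Section Frame.
Variable R : realType.
Implicit Types (A B C D E : R).

(** The quartic attains its maximum at al = 1, be = 0, where its derivative in the angle is -4B.
    Derivatives are avoided by setting s = be / al and comparing the linear term in s with the terms
    of order at least two. *)
Lemma quartic_max A B C D E :
  (forall al be, al ^+ 2 + be ^+ 2 = 1 ->
    al ^+ 4 * A - 4 * (al ^+ 3 * be * B) + 6 * (al ^+ 2 * be ^+ 2 * C)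
    - 4 * (al * be ^+ 3 * D) + be ^+ 4 * E <= A) -> B = 0.
Proof.
move=> mx.
have hom s : A - 4 * (s * B) + 6 * (s ^+ 2 * C) - 4 * (s ^+ 3 * D) + s ^+ 4 * E
    <= A * (1 + s ^+ 2) ^+ 2.
  have n0 : 0 < 1 + s ^+ 2 by have := sqr_ge0 s; lra.
  pose n := Num.sqrt (1 + s ^+ 2); have n2 : n ^+ 2 = 1 + s ^+ 2 by rewrite sqr_sqrtr // ltW.
  have np : 0 < n by rewrite sqrtr_gt0.
  have nn : n != 0 by rewrite gt_eqF.
  rewrite -n2 -ler_pdivrMr ?exprn_gt0 //.
  have /mx : (1 / n) ^+ 2 + (s / n) ^+ 2 = 1.
    by rewrite !expr_div_n n2 expr1n -mulrDl divff // gt_eqF.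
  by apply: le_trans; rewrite le_eqVlt; apply/orP; left; apply/eqP; field.
pose M := 3 * `|A| + 6 * `|C| + 4 * `|D| + `|E|.
have M0 : 0 <= M by rewrite /M !addr_ge0 ?mulr_ge0.
have bd s : `|s| <= 1 -> - (4 * (s * B)) <= s ^+ 2 * M.
  move=> s1.
  have mul1 (t r : R) : `|t| <= 1 -> t * r <= `|r|.
    move=> t1; apply: le_trans (ler_norm _) _; rewrite normrM.
    by rewrite -[leRHS]mul1r ler_wpM2r.
  have s2 : `|s ^+ 2| <= 1 by rewrite normrX exprn_ile1.
  have := (mul1 _ A s2, mul1 _ (- E) s2, mul1 _ D s1, ler_norm A, ler_norm (- C)).
  rewrite !normrN => -[[[[h1 h2] h3] h4] h5].
  have : s ^+ 2 * (2 * A + s ^+ 2 * A - 6 * C + 4 * (s * D) - s ^+ 2 * E) <= s ^+ 2 * M.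
    by rewrite ler_wpM2l ?sqr_ge0 // /M; lra.
  by have := hom s; lra.
apply/eqP/negPn/negP => Bn.
have T0 : 0 < 1 + `|B| + M by have := normr_ge0 B; lra.
(* This s lies in [-1, 1] and has sign opposite to B. With t the inverse of its denominator, the
   bound reads 4 t B^2 <= (t M) t B^2, impossible since t M <= 1. *)
have := bd (- B / (1 + `|B| + M)) _.
rewrite normrM normrN normrV ?unitfE ?gt_eqF // (gtr0_norm T0) ler_pdivrMr // mul1r.
have -> : `|B| <= 1 + `|B| + M by lra.
move=> /(_ isT).
set t := (1 + `|B| + M)^-1.
have t0 : 0 < t by rewrite invr_gt0.
have tT : t * (1 + `|B| + M) = 1 by rewrite mulVf // gt_eqF.
have B2 : 0 < B ^+ 2 by rewrite exprn_even_gt0.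
have -> : - (4 * (- B * t * B)) = 4 * (t * B ^+ 2) by ring.
have -> : (- B * t) ^+ 2 * M = (t * M) * (t * B ^+ 2) by ring.
rewrite ler_pM2r; last exact: mulr_gt0.
have : t * M <= 1 by rewrite -tT ler_wpM2l ?ltW //; have := normr_ge0 B; lra.
lra.
Qed.

(** Maximality of H_{kkkk} annihilates H_{kkki} and H_{kkkj}. Rotations about axis k preserve that
    maximum, so maximality of H_{iikk} among the maximising frames annihilates H_{ijkk}. *)
Lemma critical_frame (H : T4 R) (i j k : 'I_3) : uniq [:: i; j; k] -> inH4 H ->
  exists Q, SO3 Q /\ forall p q, p != q -> act4 Q H k k p q = 0.
Proof.
move=> ijk HH; have jki := uniq3_rot ijk; have kij := uniq3_rot jki.
have kji := uniq3_swap jki.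
have I1 : SO3 (1%:M : 'M[R]_3) by split; rewrite ?det1 // trmx1 mulmx1.
have clT : closed [set v : 'rV[R]_(3 * 3) | True]%classic.
  by rewrite (_ : [set v | _]%classic = setT) //; exact: closedT.
have [g1 [g1S _ g1max]] := @SO3_max R _ (fun=> True) (@cont9_act4 R H k k k k) clT (ex_intro _
  1%:M (conj I1 I)).
have [Q [QS Qe Qmax]] := @SO3_max R _ (fun g => act4 g H k k k k = act4 g1 H k k k k)
  (@cont9_act4 R H i i k k)
  (cont9_closed (@cont9_act4 R H k k k k))
  (ex_intro _ g1 (conj g1S erefl)).
exists Q; split=> //; set U := act4 Q H.
have HU : inH4 U by apply: inH4_act => //; exact: QS.1.
have max1 h : SO3 h -> act4 h U k k k k <= U k k k k.
  by move=> hS; rewrite /U -act4_mul Qe; apply: g1max => //; exact: SO3_mul.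
have max2 h : SO3 h -> act4 h U k k k k = U k k k k -> act4 h U i i k k <= U i i k k.
  move=> hS; rewrite /U -act4_mul Qe => e; apply: Qmax => //; exact: SO3_mul.
have Uki : U k k k i = 0.
  apply: (@quartic_max (U k k k k) _ (U k k i i) (U k i i i) (U i i i i)) => al be ab.
  apply: le_trans (max1 _ (rot_SO3 kij ab)).
  rewrite act4E /slot1 /slot2 /slot3 /slot4 /ap !(sum3 kij) !(rotE kij) !(mul0r, addr0).
  by rewrite !(sort_rules HU k i j) le_eqVlt; apply/orP; left; apply/eqP; ring.
have Ukj : U k k k j = 0.
  apply: (@quartic_max (U k k k k) _ (U k k j j) (U k j j j) (U j j j j)) => al be ab.
  apply: le_trans (max1 _ (rot_SO3 kji ab)).
  rewrite act4E /slot1 /slot2 /slot3 /slot4 /ap !(sum3 kji) !(rotE kji) !(mul0r, addr0).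
  by rewrite !(sort_rules HU k j i) le_eqVlt; apply/orP; left; apply/eqP; ring.
(* The rotated component is quadratic in (al, be); multiplying by al^2 + be^2 = 1 makes it quartic,
   with U_{ijkk} / 2 as both odd coefficients. *)
have Uij : U i j k k / 2 = 0.
  apply: (@quartic_max (U i i k k) _ ((U i i k k + U j j k k) / 6) (U i j k k / 2) (U j j k k))
    => al be ab.
  have kk : act4 (rot i j al be) U k k k k = U k k k k.
    by rewrite act4E /slot1 /slot2 /slot3 /slot4 /ap !(sum3 ijk) !(rotE ijk); ring.
  apply: le_trans (max2 _ (rot_SO3 ijk ab) kk).
  rewrite act4E /slot1 /slot2 /slot3 /slot4 /ap !(sum3 ijk) !(rotE ijk) !(mul0r, add0r, mul1r).
  rewrite !(sort_rules HU i j k) le_eqVlt; apply/orP; left; apply/eqP.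
  by rewrite -[RHS]mul1r -[X in _ = X * _]ab; field.
have {Uij} Uij : U i j k k = 0 by lra.
move=> p q; move: p q; apply: (ord3_ind ijk) => q; move: q; apply: (ord3_ind ijk);
  rewrite ?eqxx // => _; move: Uki Ukj Uij; by rewrite !(sort_rules HU i j k).
Qed.

End Frame.

(** * The equivalences in an adapted frame *)

Section Frames.
Variable R : realType.
Implicit Types (g h : 'M[R]_3) (H T : T4 R).

(** In a critical frame axis k is axial if U_{iikk} = U_{jjkk}. Otherwise the spherical d2 forces
    all odd components to vanish and U_{iijj} to equal one of these two, so that axis i or j is
    axial instead. *)
Lemma spherical_d2_noninvolutive_sym H : inH4 H -> is_scalar_mx (d2 H) ->
  exists g, symgrpT4 H g /\ g *m g <> 1%:M.
Proof.
move=> HH /is_scalar_mxP[s d2s].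
have u3 : uniq [:: 0; 1; 1 + 1 : 'I_3] by [].
have [Q [QS Qk]] := critical_frame u3 HH; move: u3 Qk.
set i : 'I_3 := 0; set j : 'I_3 := 1; set k : 'I_3 := 1 + 1 => ijk; set U := act4 Q H => Uk.
have HU : inH4 U by apply: inH4_act => //; exact: QS.1.
have d2U : d2 U = s%:M.
  rewrite d2_act ?d2s; last exact: QS.1.
  by rewrite /act2 scalar_mxC -mulmxA SO3_mulV // mulmx1.
have offU p q : p != q -> d2 U p q = 0 by move=> pq; rewrite d2U mxE (negPf pq).
have diaU p : d2 U p p = s by rewrite d2U mxE eqxx.
suff [g [gU gg]] : exists g, symgrpT4 U g /\ g *m g <> 1%:M.
  exists (Q^T *m g *m Q^T^T); split.
    by apply/symgrpT4_conj; [exact: SO3_trmx | rewrite trmxK].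
  rewrite trmxK => e; apply: gg.
  have K : Q *m (Q^T *m g *m Q *m (Q^T *m g *m Q)) *m Q^T = g *m g.
    by rewrite !mulmxA SO3_mulV // mul1mx -!mulmxA SO3_mulV // mulmx1 (mulmxA Q) SO3_mulV // mul1mx.
  by rewrite -K e mulmx1 SO3_mulV.
have [ij ik jk] := uniq3P ijk; have jki := uniq3_rot ijk; have kij := uniq3_rot jki.
have ikj := uniq3_rot (uniq3_swap ijk).
have [ab|ab] := eqVneq (U i i k k) (U j j k k).
  by apply: (axial_noninvolutive_sym HU ijk) => //; exact: offU.
have K0 := kk0_rules HU ijk Uk.
have S := sort_rules HU i j k; have T := (trace_rules HU ijk).1.
have F12 := offU _ _ ij; rewrite (d2_off HU ijk) in F12.
have F23 := offU _ _ jk; rewrite (d2_off HU jki) in F23.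
have F13 := offU _ _ ik; rewrite (d2_off HU ikj) in F13.
have Di := diaU i; rewrite (d2_diag HU ijk) in Di.
have Dj := diaU j; rewrite (d2_diag HU jki) in Dj.
have Dk := diaU k; rewrite (d2_diag HU kij) in Dk.
rewrite !S !T !K0 in F12 F23 F13 Di Dj Dk.
have [abc p0 q0 r0] : [/\ U j j k k = U i i j j \/ U i i k k = U i i j j,
    U i i i j = 0, U i i i k = 0 & U j j j k = 0].
  move: (U i i j j) (U i i k k) (U j j k k) (U i i i j) (U i i i k) (U j j j k) ab F12 F23 F13 Di
    Dj Dk.
  clear => c b a p q r ab F12 F23 F13 Di Dj Dk.
  have abn : a - b != 0 by rewrite subr_eq0 eq_sym.
  have p0 : p = 0 by apply: (mulIf abn); rewrite mul0r -[RHS]F12; ring.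
  have cE : c = - (2 * (a + b)).
    apply: (mulIf abn); have := congr2 (fun u v => u - v) Di Dj => /=; lra.
  rewrite {}p0 {}cE in F23 F13 Di Dk *.
  have Q5 : q * (a + 2 * b) = 0 by lra.
  have R5 : r * (2 * a + b) = 0 by lra.
  have N : (3 * a + 2 * b) * (2 * a + 3 * b) + q ^+ 2 + r ^+ 2 = 0 by lra.
  have [[[q2 r2] a2] b2] := (sqr_ge0 q, sqr_ge0 r, sqr_ge0 a, sqr_ge0 b).
  (* If q is nonzero then a = -2b, and [N] becomes 4 b^2 + q^2 + r^2 = 0. The argument for r is the
     same with a and b exchanged. *)
  have q0 : q = 0.
    have /eqP := Q5; rewrite mulf_eq0 => /orP[/eqP//|/eqP e].
    have aE : a = - (2 * b) by lra.
    rewrite aE in N; apply/eqP; rewrite -sqrf_eq0; apply/eqP; lra.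
  have r0 : r = 0.
    have /eqP := R5; rewrite mulf_eq0 => /orP[/eqP//|/eqP e].
    have bE : b = - (2 * a) by lra.
    rewrite bE in N; apply/eqP; rewrite -sqrf_eq0; apply/eqP; lra.
  split=> //; move/eqP: N; rewrite q0 r0 expr0n !addr0 mulf_eq0 => /orP[]/eqP e; [left|right]; lra.
have odd0 : oddfree U.
  move=> m p q; move: p q m; apply: (ord3_ind ijk) => q; move: q; apply: (ord3_ind ijk) => m;
  rewrite ?eqxx // => _; move: m; apply: (ord3_ind ijk);
  by rewrite ?S ?K0 ?p0 ?q0 ?r0 ?oppr0.
case: abc => e.
- apply: (axial_noninvolutive_sym HU ikj) => [p q|||]; try exact: offU.
  + exact: odd0.
  + by rewrite -e !S.
- apply: (axial_noninvolutive_sym HU jki) => [p q|||]; try exact: offU.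
  + exact: odd0.
  + by rewrite !S e.
Qed.

Lemma vecofE (a : 'M[R]_3) :
  (vecof a 0 0 = a 1 (1 + 1) - a (1 + 1) 1) * (vecof a 1 0 = a (1 + 1) 0 - a 0 (1 + 1)) *
  (vecof a (1 + 1) 0 = a 0 1 - a 1 0).
Proof.
have u3 : uniq [:: 0; 1; 1 + 1 : 'I_3] by [].
rewrite !mxE !(sum3 u3) /levi /= (_ : (1 %% 3 + 1 %% 3) %% 3 = 2)%N //.
by rewrite (_ : 1 %% 3 = 1)%N //; do !split; field.
Qed.

Lemma vecof_eq0 (a : 'M[R]_3) : vecof a = 0 <-> a^T = a.
Proof.
have u3 : uniq [:: 0; 1; 1 + 1 : 'I_3] by [].
split=> e.
  have c (p : 'I_3) : vecof a p 0 = 0 by rewrite e mxE.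
  have := (c 0, c 1, c (1 + 1)); rewrite !vecofE => -[[e0 e1] e2].
  apply/matrixP => p q; rewrite mxE; move: p q.
  by apply: (ord3_ind u3) => q; move: q; apply: (ord3_ind u3) => //; clear e c; lra.
have {}e p q : a p q = a q p by rewrite -[in LHS]e mxE.
apply/colP; apply: (ord3_ind u3); rewrite vecofE [RHS]mxE.
- by rewrite e subrr.
- by rewrite e subrr.
- by rewrite e subrr.
Qed.

(** Transposing ab gives ba, so the vanishing of [v5] and [v6] means that d2 commutes with c3 and
    c4. *)
Lemma vecof_mul_eq0 (a b : 'M[R]_3) : symmx a -> symmx b -> vecof (a *m b) = 0 <-> a *m b = b *m a.
Proof. by rewrite vecof_eq0 trmx_mul => -> ->; split=> ->. Qed.

Lemma offdiag0_mulC (a b : 'M[R]_3) : offdiag0 a -> offdiag0 b -> a *m b = b *m a.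
Proof.
have mulE (c d : 'M[R]_3) p q : offdiag0 c -> (c *m d) p q = c p p * d p q.
  move=> c0; rewrite mxE (bigD1 p) //= big1 ?addr0 // => r rp.
  by rewrite c0 1?eq_sym // mul0r.
move=> a0 b0; apply/matrixP => p q; rewrite !mulE //.
by have [->|pq] := eqVneq p q; [exact: mulrC | rewrite (a0 p q) // (b0 p q) // !mulr0].
Qed.

Definition pairset H (a : 'M[R]_3) := a = d2 H \/ a = c3 H.

Lemma symgrpT4_fix H g : symgrpT4 H g ->
  [/\ act2 g (d2 H) = d2 H, act2 g (c3 H) = c3 H & act2 g (c4 H) = c4 H].
Proof.
move=> /symgrpT4P[gS e]; have gg := gS.1.
by split; rewrite -?d2_act -?c3_act -?c4_act ?e.
Qed.

Lemma symgrpT4_pairset H g : symgrpT4 H g -> symgrpSet (pairset H) g.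
Proof. by move=> gH; have [? ? _] := symgrpT4_fix gH; split; [exact: gH.1|move=> a [->|->]]. Qed.

Lemma D2_oddfree_sep H : inH4 H -> (forall g, symgrpT4 H g <-> D2 g) ->
  [/\ oddfree H, offdiag0 (d2 H), offdiag0 (c3 H), offdiag0 (c4 H) &
   forall p q, p != q -> ~ (d2 H p p = d2 H q q /\ c3 H p p = c3 H q q)].
Proof.
move=> HH HD.
have odd0 : oddfree H by apply/D2_fix_oddfree => // d /HD/symgrpT4P[].
have d0 : offdiag0 (d2 H) by apply/D2_fix_offdiag0 => d /HD/symgrpT4_fix[].
have z0 : offdiag0 (c3 H) by apply/D2_fix_offdiag0 => d /HD/symgrpT4_fix[].
have w0 : offdiag0 (c4 H) by apply/D2_fix_offdiag0 => d /HD/symgrpT4_fix[].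
split=> // i j ij [xij zij]; have [k ijk] := ord3_third ij.
have [_ ik jk] := uniq3P ijk; have jki := uniq3_rot ijk; have kij := uniq3_rot jki.
(* Equality would make the quarter-turn about axis r a symmetry, and this rotation is not in
   [D2]. *)
have dist p q r : uniq [:: p; q; r] -> H p p r r - H q q r r != 0.
  move=> pqr; have [_ pr qr] := uniq3P pqr; rewrite subr_eq0; apply/eqP => e.
  apply: (@rot_notD2 R p q r pqr 0 1); rewrite ?oner_eq0 //; apply/HD.
  by apply: (rot90_fix HH pqr) => //; [move=> s t; exact: odd0|exact: odd0|exact: odd0].
have xE p q r : uniq [:: p; q; r] -> d2 H p p - d2 H q q =
    (H p p r r - H q q r r) * (4 * H q q r r + 4 * H p p r r + 2 * H p p q q).
  move=> pqr; have [pq pr qr] := uniq3P pqr.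
  rewrite (d2_diag HH pqr) (d2_diag HH (uniq3_swap pqr)) !(sort_rules HH p q r).
  have := (odd0 r p q pq, odd0 q p r pr, odd0 p q r qr);
    rewrite !(sort_rules HH p q r) => -[[-> ->] ->].
  have := (odd0 p p q pq, odd0 q p q pq, odd0 p p r pr);
    rewrite !(sort_rules HH p q r) => -[[-> ->] ->].
  have := (odd0 q q r qr, odd0 r p r pr, odd0 r q r qr);
    rewrite !(sort_rules HH p q r) => -[[-> ->] ->].
  by rewrite !(trace_rules HH pqr).1; ring.
have zE : c3 H i i - c3 H j j = (H i i k k - H j j k k) * (d2 H k k - d2 H i i).
  rewrite /c3 !(dd2_diag HH ijk d0) xij !(sort_rules HH i j k) !(trace_rules HH ijk).1; ring.
have xik : d2 H k k = d2 H i i.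
  apply/eqP; rewrite -subr_eq0 -(mulrI_eq0 _ (mulfI (dist _ _ _ ijk))) -zE zij subrr //.
have := xE _ _ _ ijk; have := xE _ _ _ kij; rewrite xik xij !subrr.
have := (dist _ _ _ ijk, dist _ _ _ kij, dist _ _ _ jki); rewrite !(sort_rules HH i j k).
move: (H i i j j) (H i i k k) (H j j k k); clear => c b a [[n1 n2] n3].
move/esym/eqP; rewrite mulf_eq0 (negPf n2) /= => /eqP e2.
move/esym/eqP; rewrite mulf_eq0 (negPf n1) /= => /eqP e1.
(* Subtracting [e2] from [e1] gives b = c, which [n3] forbids; the stated equation holds by
   contradiction. *)
have /eqP : a - b = 0 by lra.
by rewrite -opprB oppr_eq0 (negPf n1).
Qed.

Lemma D2_frame_forward H : inH4 H -> (forall g, symgrpT4 H g <-> D2 g) ->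
  [/\ forall g, symgrpSet (pairset H) g <-> D2 g,
   d2 H *m c3 H = c3 H *m d2 H & d2 H *m c4 H = c4 H *m d2 H].
Proof.
move=> HH HD; have [_ d0 z0 w0 sep] := D2_oddfree_sep HH HD.
by split; [exact/pair_symgrp_D2 | exact: offdiag0_mulC | exact: offdiag0_mulC].
Qed.

Lemma D2_frame_backward H : inH4 H -> d2 H *m c4 H = c4 H *m d2 H ->
  (forall g, symgrpSet (pairset H) g <-> D2 g) -> forall g, symgrpT4 H g <-> D2 g.
Proof.
move=> HH comm pD g; have /pair_symgrp_D2[d0 z0 sep] := pD.
split=> [/symgrpT4_pairset/pD//|gD]; apply/symgrpT4P; split; first by have /D2_SO3[] := gD.
by move: g gD; apply/D2_fix_oddfree => //; exact: covariants_oddfree.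
Qed.

Lemma D2_frame_Cov2 H : inH4 H -> (forall g, symgrpT4 H g <-> D2 g) ->
  forall g, symgrpSet (Cov2 H) g <-> D2 g.
Proof.
move=> HH HD g; have [pD _ _] := D2_frame_forward HH HD.
split=> [[gS gC]|/HD]; last exact: symgrpT4_Cov2.
by apply/pD; split=> // a [->|->]; apply: gC; [exact: Cov2_d2|exact: Cov2_c3].
Qed.

(** Symmetries of H fix all covariants, hence lie in [D2], whose elements are involutions; a
    symmetry of order 3 or 4 is thereby excluded. *)
Lemma D2_Cov2_invol H g : inH4 H -> (forall g, symgrpSet (Cov2 H) g <-> D2 g) ->
  symgrpT4 H g -> g *m g = 1%:M.
Proof.
move=> HH CD /(symgrpT4_Cov2 HH)/CD/D2_SO3[gS g0].
have e : g^T = g.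
  apply/matrixP => p q; rewrite mxE; have [->//|pq] := eqVneq p q.
  by rewrite !g0 // eq_sym.
by rewrite -{1}e gS.1.
Qed.

Lemma D2_frame_of_Cov2 H : inH4 H -> (forall g, symgrpSet (Cov2 H) g <-> D2 g) ->
  forall g, symgrpT4 H g <-> D2 g.
Proof.
move=> HH CD.
have fixC a : Cov2 H a -> offdiag0 a.
  by move=> Ca; apply/D2_fix_offdiag0 => d /CD[_]; apply.
have d0 := fixC _ (Cov2_d2 H); have z0 := fixC _ (Cov2_c3 H); have w0 := fixC _ (Cov2_c4 H).
apply: D2_frame_backward => //; first exact: offdiag0_mulC.
apply/pair_symgrp_D2; split=> // i j ij [xij zij]; have [k ijk] := ord3_third ij.
have [_ ik jk] := uniq3P ijk.
suff [g [gH gg]] : exists g, symgrpT4 H g /\ g *m g <> 1%:M.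
  exact: gg (D2_Cov2_invol HH CD gH).
have [xik|xik] := eqVneq (d2 H k k) (d2 H i i).
  apply: spherical_d2_noninvolutive_sym => //; apply/is_scalar_mxP; exists (d2 H i i).
  apply/matrixP => p q; rewrite [RHS]mxE; have [<-|/d0->//] := eqVneq p q.
  by move: p; apply: (ord3_ind ijk); rewrite ?xik ?xij.
have xn : d2 H k k - d2 H i i != 0 by rewrite subr_eq0.
(* Since x_i = x_j, the trace condition reduces c3_{pq} = 0 to (x_k - x_i) H_{kkpq} = 0. *)
have kk0 p q : p != q -> H k k p q = 0.
  move=> pq; apply: (mulIf xn); rewrite mul0r -[RHS](z0 p q pq) /c3 (dd2_diag HH ijk d0) -xij.
  have := HH.2.2.2 p q; rewrite (sum3 ijk) => e.
  have -> : H j j p q = - H i i p q - H k k p q by lra.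
  ring.
apply: (axial_noninvolutive_sym HH ijk) => //; [|exact: d0|exact: d0].
(* Here z_i - z_j = (H_{iikk} - H_{jjkk})(x_k - x_i), and z_i = z_j. *)
apply: (mulIf xn); apply/eqP; rewrite -subr_eq0 -mulrBl; apply/eqP.
rewrite -(subrr (c3 H i i)) {2}zij /c3 !(dd2_diag HH ijk d0) -xij.
rewrite !(sort_rules HH i j k) !(trace_rules HH ijk).1; ring.
Qed.

End Frames.

(** * Transport from the adapted frame to an arbitrary one *)

Theorem theorem9p11 (R : realType) (H : T4 R) (HH : inH4 H) :
  (orthotropic_grp (symgrpSet (Cov2 H)) <-> orthotropic_grp (symgrpT4 H)) /\
  (orthotropic_grp (symgrpT4 H) <->
     (v5 H = 0 /\ v6 H = 0 /\
      orthotropic_grp (symgrpSet (fun a => a = d2 H \/ a = c3 H)))) /\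
  (orthotropic_grp (symgrpT4 H) ->
     forall g, symgrpT4 H g <->
       symgrpSet (fun a => a = d2 H \/ a = c3 H \/ a = c4 H) g).
Proof.
have HQ Q : SO3 Q -> inH4 (act4 Q^T H).
  by move=> /SO3_trmx QS; apply: inH4_act => //; exact: QS.1.
have covH : orthotropic_grp (symgrpSet (Cov2 H)) <->
    exists Q, SO3 Q /\ forall g, symgrpSet (Cov2 (act4 Q^T H)) g <-> D2 g.
  rewrite orthotropic_conj; split=> -[Q [QS QD]]; exists Q; split=> // g; rewrite -QD.
    by apply: iff_sym; apply: symgrpSet_conj => // a; exact: Cov2_act.
  by apply: symgrpSet_conj => // a; exact: Cov2_act.
have tenH : orthotropic_grp (symgrpT4 H) <->
    exists Q, SO3 Q /\ forall g, symgrpT4 (act4 Q^T H) g <-> D2 g.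
  rewrite orthotropic_conj; split=> -[Q [QS QD]]; exists Q; split=> // g; rewrite -QD.
    by apply: iff_sym; exact: symgrpT4_conj.
  exact: symgrpT4_conj.
have pairQ Q g : SO3 Q -> symgrpSet (pairset H) (Q *m g *m Q^T) <->
    symgrpSet (pairset (act4 Q^T H)) g.
  move=> QS; have QS' := SO3_trmx QS; apply: symgrpSet_conj => // a.
  rewrite /pairset (d2_act _ QS'.1) (c3_act _ QS'.1); split=> -[e|e];
    by [left; rewrite e act2KV | right; rewrite e act2KV | left; rewrite -e act2K | right;
      rewrite -e act2K].
have pairH : orthotropic_grp (symgrpSet (fun a => a = d2 H \/ a = c3 H)) <->
    exists Q, SO3 Q /\ forall g, symgrpSet (pairset (act4 Q^T H)) g <-> D2 g.
  rewrite orthotropic_conj; split=> -[Q [QS QD]]; exists Q; split=> // g; rewrite -QD.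
    by apply: iff_sym; exact: pairQ.
  exact: pairQ.
have sd := d2_sym HH; have sc3 : symmx (c3 H) by exact: dd2_sym.
have sc4 : symmx (c4 H) by exact: dd2_sym.
have act2M Q (a b : 'M[R]_3) : SO3 Q -> act2 Q^T a *m act2 Q^T b = act2 Q^T (a *m b).
  move=> QS; rewrite /act2 trmxK !mulmxA -(mulmxA _ Q Q^T) SO3_mulV //.
  by rewrite mulmx1.
have act2I Q : SO3 Q -> injective (act2 Q^T : 'M[R]_3 -> 'M[R]_3).
  by move=> QS; exact: can_inj (act2KV QS).
split; [|split].
- rewrite covH tenH; split=> -[Q [QS QD]]; exists Q; split=> //.
    exact: D2_frame_of_Cov2 (HQ _ QS) QD.
  exact: D2_frame_Cov2 (HQ _ QS) QD.
- rewrite tenH pairH /v5 /v6 !vecof_mul_eq0 //; split.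
    move=> [Q [QS QD]]; have QS' := SO3_trmx QS.
    have [pD] := D2_frame_forward (HQ _ QS) QD.
    rewrite (d2_act _ QS'.1) (c3_act _ QS'.1) (c4_act _ QS'.1) !act2M //.
    by move=> /(act2I _ QS) e5 /(act2I _ QS) e6; split=> //; split=> //; exists Q.
  move=> [_ [e6 [Q [QS QD]]]]; exists Q; split=> //; have QS' := SO3_trmx QS.
  apply: D2_frame_backward (HQ _ QS) _ QD.
  by rewrite (d2_act _ QS'.1) (c4_act _ QS'.1) !act2M // e6.
- move=> /tenH[Q [QS QD]] g; split=> [gH|[gS gF]].
    by have [? ? ?] := symgrpT4_fix gH; split; [exact: gH.1 | move=> a [->|[->|->]]].
  (* A rotation fixing the triple fixes the pair, whose group is the conjugate of [D2] by Q, as is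
     the group of H. *)
  have [pD _ _] := D2_frame_forward (HQ _ QS) QD.
  have K : Q *m (Q^T *m g *m Q) *m Q^T = g.
    by rewrite !mulmxA SO3_mulV // mul1mx -mulmxA SO3_mulV // mulmx1.
  rewrite -K; apply/symgrpT4_conj => //; apply/QD/pD/pairQ => //; rewrite K.
  by split=> // a [->|->]; apply: gF; [left|right; left].
Qed.
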